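(* Let $F_{4a}=\Delta/E_4^2$ and $F_{4b}=E_4\Delta/E_6^2$, viewed as $q$-series. Both lie in $q\mathbb{Z}[[q]]$. Writing $F=\sum_{n\ge1}a_nq^n$ for either $F\in\{F_{4a},F_{4b}\}$, the formal anti-derivative $\delta^{-1}F=\sum_{n\ge1}\frac{a_n}{n}q^n$ has integer coefficients, i.e. $n\mid a_n$ for every $n\ge1$.
   Context: Let $q=e^{2\pi i\tau}$ for $\tau$ in the upper half-plane and $\delta=\frac{1}{2\pi i}\frac{d}{d\tau}=q\frac{d}{dq}$. The Eisenstein series are $E_2=1-24\sum_{n\ge1}\frac{nq^n}{1-q^n}$, $E_4=1+240\sum_{n\ge1}\frac{n^3q^n}{1-q^n}$, $E_6=1-504\sum_{n\ge1}\frac{n^5q^n}{1-q^n}$, and $\Delta=q\prod_{m\ge1}(1-q^m)^{24}=(E_4^3-E_6^2)/1728$. Quotients are expanded as formal power series in $q$ (note $E_4,E_6\in 1+q\mathbb{Z}[[q]]$ are invertible in $\mathbb{Z}[[q]]$). For $F=\sum_{n\ge1}a_nq^n$ the anti-derivative is $\delta^{-1}F=\sum_{n\ge1}\frac{a_n}{n}q^n$. *)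

(* Defs.v *)
From HB Require Import structures.
From mathcomp Require Import all_boot all_order all_algebra boolp.

Set Implicit Arguments.
Unset Strict Implicit.
Unset Printing Implicit Defensive.

Import Order.TTheory GRing.Theory Num.Theory.
Local Open Scope ring_scope.

(* Formal power series in one variable q.  A record rather than a bare function
   type, so that * is the Cauchy product and never the pointwise one. *)
Record fps (R : Type) := Fps { coefq : nat -> R }.

Lemma fpsP (R : Type) (f g : fps R) : (forall n, coefq f n = coefq g n) -> f = g.
Proof. by case: f g => [f] [g] /= fg; congr Fps; apply/funext. Qed.

HB.instance Definition _ (R : Type) := gen_eqMixin (fps R).
HB.instance Definition _ (R : Type) := gen_choiceMixin (fps R).

Section Zmodule.
Variable R : zmodType.
Implicit Types f g h : fps R.

Definition fps_zero : fps R := Fps (fun=> 0).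
Definition fps_opp f := Fps (fun n => - coefq f n).
Definition fps_add f g := Fps (fun n => coefq f n + coefq g n).

Fact fps_addA : associative fps_add.
Proof. by move=> f g h; apply: fpsP => n /=; rewrite addrA. Qed.
Fact fps_addC : commutative fps_add.
Proof. by move=> f g; apply: fpsP => n /=; rewrite addrC. Qed.
Fact fps_add0 : left_id fps_zero fps_add.
Proof. by move=> f; apply: fpsP => n /=; rewrite add0r. Qed.
Fact fps_addN : left_inverse fps_zero fps_opp fps_add.
Proof. by move=> f; apply: fpsP => n /=; rewrite addNr. Qed.

HB.instance Definition _ :=
  GRing.isZmodule.Build (fps R) fps_addA fps_addC fps_add0 fps_addN.

Lemma coefq0 n : coefq (0 : fps R) n = 0. Proof. by []. Qed.
Lemma coefqN f n : coefq (- f) n = - coefq f n. Proof. by []. Qed.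
Lemma coefqD f g n : coefq (f + g) n = coefq f n + coefq g n. Proof. by []. Qed.
Lemma coefqB f g n : coefq (f - g) n = coefq f n - coefq g n. Proof. by []. Qed.

Lemma coefq_sum (I : Type) (r : seq I) (P : pred I) (F : I -> fps R) n :
  coefq (\sum_(i <- r | P i) F i) n = \sum_(i <- r | P i) coefq (F i) n.
Proof. by elim/big_rec2: _ => // i _ f _ <-. Qed.

End Zmodule.

Section ComRing.
Variable R : comNzRingType.
Implicit Types f g h : fps R.

Definition fpsC (c : R) : fps R := Fps (fun n => if n == 0%N then c else 0).
Definition fps_mul f g :=
  Fps (fun n => \sum_(j < n.+1) coefq f j * coefq g (n - j)).

Let trunc N f := \poly_(i < N) coefq f i.

Let coefq_mul_trunc N f g n :
  (n < N)%N -> coefq (fps_mul f g) n = (trunc N f * trunc N g)`_n.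
Proof.
move=> ltnN; rewrite coefM; apply: eq_bigr => j _.
have jN : (j < N)%N by apply: leq_trans ltnN; rewrite ltnS -ltnS.
by rewrite !coef_poly jN (leq_ltn_trans (leq_subr _ _) ltnN).
Qed.

Fact fps_mulC : commutative fps_mul.
Proof.
by move=> f g; apply: fpsP => n; rewrite !(coefq_mul_trunc _ _ (ltnSn n)) mulrC.
Qed.

Fact fps_mulA : associative fps_mul.
Proof.
move=> f g h; apply: fpsP => n.
have E k l m : coefq (fps_mul k (fps_mul l m)) n
    = (trunc n.+1 k * (trunc n.+1 l * trunc n.+1 m))`_n.
  rewrite coefM; apply: eq_bigr => j _; rewrite coef_poly ltn_ord.
  by rewrite -coefq_mul_trunc // ltnS leq_subr.
by rewrite (fps_mulC (fps_mul f g)) !E mulrA mulrC.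
Qed.

Fact fps_mul1 : left_id (fpsC 1) fps_mul.
Proof.
move=> f; apply: fpsP => n /=; rewrite big_ord_recl /= mul1r subn0.
by rewrite big1 ?addr0 // => j _; rewrite mul0r.
Qed.

Fact fps_mulDl : left_distributive fps_mul +%R.
Proof.
move=> f g h; apply: fpsP => n /=; rewrite -big_split /=.
by apply: eq_bigr => j _; rewrite mulrDl.
Qed.

Fact fps_oner_neq0 : fpsC 1 != 0.
Proof. by apply/eqP => /(congr1 (fun h => coefq h 0)) /= /eqP; rewrite oner_eq0. Qed.

HB.instance Definition _ := GRing.Zmodule_isComNzRing.Build (fps R)
  fps_mulA fps_mulC fps_mul1 fps_mulDl fps_oner_neq0.

Lemma coefqM f g n :
  coefq (f * g) n = \sum_(j < n.+1) coefq f j * coefq g (n - j).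
Proof. by []. Qed.

Lemma coefq1 n : coefq (1 : fps R) n = (n == 0%N)%:R.
Proof. by case: n. Qed.

Lemma coefq0M f g : coefq (f * g) 0 = coefq f 0 * coefq g 0.
Proof. by rewrite coefqM big_ord1. Qed.

Lemma fpsCM c d : fpsC (c * d) = fpsC c * fpsC d.
Proof.
apply: fpsP => n; rewrite coefqM big_ord_recl /= subn0.
rewrite big1 ?addr0 => [|j _]; last by rewrite mul0r.
by case: n => [|n] //=; rewrite mulr0.
Qed.

Definition qdvd n f := forall i, (i < n)%N -> coefq f i = 0.

Lemma qdvdMl n f g : qdvd n g -> qdvd n (f * g).
Proof.
move=> g0 i lin; rewrite coefqM big1 // => j _.
by rewrite g0 ?mulr0 // (leq_ltn_trans (leq_subr _ _) lin).
Qed.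

Lemma qdvdMr n f g : qdvd n f -> qdvd n (f * g).
Proof. by rewrite mulrC; apply: qdvdMl. Qed.

Lemma qdvdX f n : coefq f 0 = 0 -> qdvd n (f ^+ n).
Proof.
move=> f0; elim: n => [|n IHn] // i; rewrite ltnS exprS coefqM => lein.
rewrite big_ord_recl f0 mul0r add0r big1 // => j _; rewrite IHn ?mulr0 //.
rewrite /= /bump /= add1n; case: i lein j => [|i] lein j; first by case: j.
by rewrite subSS (leq_ltn_trans (leq_subr _ _) lein).
Qed.

(* The q-adic limit of a sequence that is coefficientwise stationary in the
   sense of [qcvg]; this makes sense of infinite sums and products. *)
Definition qlim (u : nat -> fps R) : fps R := Fps (fun n => coefq (u n) n).
Definition qcvg (u : nat -> fps R) :=
  forall n N, (n <= N)%N -> coefq (u N) n = coefq (u n) n.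

Lemma qcvgS (u : nat -> fps R) :
  (forall N, qdvd N.+1 (u N.+1 - u N)) -> qcvg u.
Proof.
move=> du n N /subnKC <-; elim: (N - n)%N => [|d IHd]; first by rewrite addn0.
rewrite -IHd addnS; apply/eqP; rewrite -subr_eq0 -coefqB; apply/eqP/du.
by rewrite ltnS leq_addr.
Qed.

Lemma qcvgP u n : qcvg u -> qdvd n.+1 (u n - qlim u).
Proof. by move=> cu i lein; rewrite coefqB cu // subrr. Qed.

Definition fpsq : fps R := Fps (fun n => (n == 1%N)%:R).

Lemma qdvd_fpsqX n : qdvd n (fpsq ^+ n). Proof. exact: qdvdX. Qed.

End ComRing.

Section Inverse.
Variable R : comUnitRingType.
Implicit Types f g : fps R.

Definition fps_unit : pred (fps R) := fun f => coefq f 0 \is a GRing.unit.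

(* Geometric series: 1/f = (1/a) * sum_i (1 - f/a)^i, where a is the constant
   coefficient of f. *)
Definition fps_geom f (N : nat) : fps R :=
  \sum_(i < N.+1) (1 - fpsC (coefq f 0)^-1 * f) ^+ i.
Definition fps_inv f : fps R :=
  if fps_unit f then fpsC (coefq f 0)^-1 * qlim (fps_geom f) else f.

Fact fps_mulVf : {in fps_unit, left_inverse 1 fps_inv *%R}.
Proof.
move=> f uf; rewrite /fps_inv (_ : fps_unit f) //.
set c := fpsC _; set u := 1 - c * f.
have u0 : coefq u 0 = 0.
  by rewrite coefqB coefq0M coefq1 /= mulVr ?subrr.
have cu : qcvg (fps_geom f).
  apply: qcvgS => N; rewrite /fps_geom -/c -/u [X in X - _]big_ord_recr /= addrAC subrr add0r.
  exact: qdvdX.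
rewrite mulrAC.
have -> : c * f = 1 - u by rewrite /u subKr.
apply: fpsP => n; apply/eqP; rewrite -subr_eq0 -coefqB; apply/eqP.
have -> : (1 - u) * qlim (fps_geom f) - 1
    = - (u ^+ n.+1) - (1 - u) * (fps_geom f n - qlim (fps_geom f)).
  have -> : - u ^+ n.+1 = (1 - u) * fps_geom f n - 1.
    by rewrite -(opprB u) mulNr /fps_geom -/c -/u -subrX1 opprB addrAC subrr add0r.
  by rewrite mulrBr [X in _ = _ + X]opprB [RHS]addrC [RHS]addrA subrK.
have := qdvdX u0 (ltnSn n); have := qdvdMl (1 - u) (qcvgP cu) (ltnSn n).
by rewrite coefqB coefqN => -> ->; rewrite !oppr0 addr0.
Qed.

Fact fps_unitPl f g : g * f = 1 -> fps_unit f.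
Proof.
move/(congr1 (fun h => coefq h 0)); rewrite /= big_ord1 /= => gf1.
by apply/unitrPr; exists (coefq g 0); rewrite mulrC.
Qed.

Fact fps_inv_out : {in [predC fps_unit], fps_inv =1 id}.
Proof. by move=> f; rewrite inE /= -topredE /= /fps_inv => /negPf ->. Qed.

HB.instance Definition _ := GRing.ComNzRing_hasMulInverse.Build (fps R)
  fps_mulVf fps_unitPl fps_inv_out.

Lemma fps_unitE f : (f \is a GRing.unit) = (coefq f 0 \is a GRing.unit).
Proof. by []. Qed.

End Inverse.

Local Notation q := (fpsq rat).

Definition lambert_partial (k N : nat) : fps rat :=
  \sum_(1 <= n < N.+1) (n ^ k)%:R * (q ^+ n / (1 - q ^+ n)).
Definition lambert (k : nat) : fps rat := qlim (lambert_partial k).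

Lemma lambert_cvg k : qcvg (lambert_partial k).
Proof.
apply: qcvgS => N; rewrite /lambert_partial [X in X - _]big_nat_recr //= addrAC subrr add0r.
by apply: qdvdMl; apply: qdvdMr; apply: qdvd_fpsqX.
Qed.

Definition E4 : fps rat := 1 + 240 * lambert 3.
Definition E6 : fps rat := 1 - 504 * lambert 5.

Definition euler24_partial (N : nat) : fps rat :=
  \prod_(1 <= m < N.+1) (1 - q ^+ m) ^+ 24.
Definition Delta : fps rat := q * qlim euler24_partial.

Lemma euler24_cvg : qcvg euler24_partial.
Proof.
apply: qcvgS => N; rewrite /euler24_partial [X in X - _]big_nat_recr //=.
rewrite -[X in _ * _ - X]mulr1 -mulrBr; apply: qdvdMl.
rewrite subrX1; apply: qdvdMr; rewrite addrAC subrr add0r -mulN1r.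
by apply: qdvdMl; apply: qdvd_fpsqX.
Qed.

Lemma lambert_coef0 k : coefq (lambert k) 0 = 0.
Proof. by rewrite /= /lambert_partial big_geq. Qed.

Lemma E4_unit : E4 \is a GRing.unit.
Proof. by rewrite fps_unitE coefqD coefq0M lambert_coef0 mulr0 addr0. Qed.

Lemma E6_unit : E6 \is a GRing.unit.
Proof. by rewrite fps_unitE coefqB coefq0M lambert_coef0 mulr0 subr0. Qed.

Definition F4a : fps rat := Delta / E4 ^+ 2.
Definition F4b : fps rat := E4 * Delta / E6 ^+ 2.

(* The inverse of q d/dq; meant for series without constant coefficient, whose
   image again has none (division by 0 yields 0). *)
Definition antideriv (F : fps rat) : fps rat :=
  Fps (fun n => coefq F n / n%:R).

(* Main.v *)
Require Import Defs.
From HB Require Import structures.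
From mathcomp Require Import all_boot all_order all_algebra boolp.
From mathcomp Require Import ring lra zify.

Set Implicit Arguments.
Unset Strict Implicit.
Unset Printing Implicit Defensive.

Import Order.TTheory GRing.Theory Num.Theory.
Local Open Scope ring_scope.

(** Put t = Delta / E4^3 = 1/j and theta = t d/dt = (E4/E6) q d/dq.  Ramanujan's
    differential equations give a third order equation for E4^(1/2) in theta,
    whose only power series solution with constant term 1 is
      E4^(1/2) = sum_k (6k)!/((3k)! k!^3) t^k,
    while E6^2 = E4^3 (1 - 1728 t) gives
      E4^(3/2)/E6 = sum_m C(2m,m) 432^m t^m.
    As q dt/dq = t E6/E4, the forms F4a dq/q and F4b dq/q are E4^(1/2) times
    E4^(3/2)/E6, respectively (E4^(3/2)/E6)^3, times dt.  Integrating in t, the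
    integrality of the anti-derivative reduces to the divisibility of
    (6k)!/((3k)! k!^3) C(2m,m) by k + m + 1.
    Ramanujan's equations are convolution identities for divisor sums; they
    follow from a bijection between solutions of a x + b y = n (Skoruppa). *)

Local Notation "''q'" := (fpsq rat).

(** * Convolutions of divisor sums *)

Definition factor_pairs (n : nat) : seq (nat * nat) :=
  [seq p <- [seq (d, z) | d <- iota 1 n, z <- iota 1 n] | (p.1 * p.2 == n)%N].

(** An entry [((a, x), (b, y))] is a solution of a x + b y = n in positive integers; [a] and [b] are
    the divisors whose powers enter a product of two Lambert series, [x] and [y] their cofactors. *)
Definition quads (n : nat) : seq ((nat * nat) * (nat * nat)) :=
  [seq u <- [seq (p, p') | p <- [seq (d, z) | d <- iota 1 n, z <- iota 1 n],
                           p' <- [seq (d, z) | d <- iota 1 n, z <- iota 1 n]]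
  | (u.1.1 * u.1.2 + u.2.1 * u.2.2 == n)%N].

Lemma mem_box n (p : nat * nat) :
  (p \in [seq (d, z) | d <- iota 1 n, z <- iota 1 n])
  = [&& 0 < p.1, p.1 <= n, 0 < p.2 & p.2 <= n]%N.
Proof.
case: p => d z; apply/allpairsP/idP => [[[d' z'] /= []]|].
  by rewrite !mem_iota => ? ? [-> ->]; lia.
by move=> H; exists (d, z); rewrite !mem_iota /=; split => //; move: H => /=; lia.
Qed.

Lemma mem_factor_pairs n (p : nat * nat) :
  (p \in factor_pairs n) = [&& 0 < p.1, 0 < p.2 & p.1 * p.2 == n]%N.
Proof.
rewrite mem_filter mem_box; case: p => d z /=.
apply/idP/idP; first by lia.
by move=> /and3P[d0 z0 /eqP <-]; rewrite eqxx d0 z0 leq_pmulr // leq_pmull.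
Qed.

Lemma mem_quads n u :
  (u \in quads n) = [&& 0 < u.1.1, 0 < u.1.2, 0 < u.2.1, 0 < u.2.2
                      & u.1.1 * u.1.2 + u.2.1 * u.2.2 == n]%N.
Proof.
case: u => [[a x] [b y]]; rewrite mem_filter /=; apply/andP/idP.
  move=> [e /allpairsP[[p p'] /= [Hp Hp' [e1 e2]]]]; subst p p'.
  by move: Hp Hp'; rewrite !mem_box /=; lia.
move=> /and5P[a0 x0 b0 y0 /eqP <-]; rewrite eqxx; split=> //.
apply/allpairsP; exists ((a, x), (b, y)); rewrite !mem_box /=.
by split=> //; nia.
Qed.

Lemma uniq_box n : uniq [seq (d, z) | d <- iota 1 n, z <- iota 1 n].
Proof.
by apply: allpairs_uniq; rewrite ?iota_uniq // => -[a b] [c d] _ _ [-> ->].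
Qed.

Lemma uniq_factor_pairs n : uniq (factor_pairs n).
Proof. by rewrite filter_uniq // uniq_box. Qed.

Lemma uniq_quads n : uniq (quads n).
Proof.
rewrite filter_uniq //; apply: allpairs_uniq; rewrite ?uniq_box //.
by move=> [a b] [c d] _ _ [-> ->].
Qed.

Lemma big_bij (V : nmodType) (I J : eqType) (r : seq I) (s : seq J)
    (P : pred I) (Q : pred J) (h : I -> J) (k : J -> I) (F : J -> V) :
    uniq r -> uniq s ->
    (forall i, i \in r -> P i -> [/\ h i \in s, Q (h i) & k (h i) = i]) ->
    (forall j, j \in s -> Q j -> [/\ k j \in r, P (k j) & h (k j) = j]) ->
  \sum_(i <- r | P i) F (h i) = \sum_(j <- s | Q j) F j.
Proof.
move=> ur us hk kh; rewrite -big_filter -[RHS]big_filter.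
rewrite -(big_map h predT F); apply: perm_big; apply: uniq_perm.
- rewrite map_inj_in_uniq ?filter_uniq // => i j.
  rewrite !mem_filter => /andP[Pi ri] /andP[Pj rj] e.
  by have [_ _ <-] := hk i ri Pi; have [_ _ <-] := hk j rj Pj; rewrite e.
- by rewrite filter_uniq.
move=> j; rewrite mem_filter; apply/mapP/andP => [[i]|[Qj sj]].
  by rewrite mem_filter => /andP[Pi ri] ->; case: (hk i ri Pi).
by have [rk Pk e] := kh j sj Qj; exists (k j); rewrite // mem_filter Pk.
Qed.
Lemma uniq_dep_pairs (T : eqType) (r : seq T) (N : T -> nat) :
  uniq r -> uniq [seq (p, y) | p <- r, y <- iota 1 (N p)].
Proof.
move=> ur; apply: (@allpairs_uniq_dep _ (fun=> nat)) => //.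
  by move=> p _; apply: iota_uniq.
by move=> [a b] [c d] _ _ /= [-> ->].
Qed.

(** When a = b the equation reads a (x + y) = n, and a factorisation n = d z arises from the z - 1
    ways of writing z as x + y. *)
Lemma sum_quads_diag_d n (F : nat -> rat) :
  \sum_(u <- quads n | u.1.1 == u.2.1) F u.1.1
  = \sum_(p <- factor_pairs n) (p.2%:R - 1) * F p.1.
Proof.
pose T := [seq (p, y) | p <- factor_pairs n, y <- iota 1 p.2.-1].
have -> : \sum_(p <- factor_pairs n) (p.2%:R - 1) * F p.1
    = \sum_(t <- T) F t.1.1.
  rewrite big_allpairs_dep /= !big_seq; apply: eq_bigr => p.
  rewrite mem_factor_pairs => /and3P[_ p2 _].
  rewrite big_const_seq count_predT size_iota iter_addr_0.
  by rewrite -[in LHS](prednK p2) -natr1 addrK mulr_natl.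
apply: (big_bij (h := fun u : (nat * nat) * (nat * nat) =>
                  ((u.1.1, (u.1.2 + u.2.2)%N), u.2.2))
                (k := fun t : (nat * nat) * nat =>
                  ((t.1.1, (t.1.2 - t.2)%N), (t.1.1, t.2)))
                (fun t => F t.1.1)).
- exact: uniq_quads.
- exact: (uniq_dep_pairs _ (uniq_factor_pairs n)).
- move=> [[a x] [b y]]; rewrite mem_quads /= => H /eqP e; subst b; split=> //.
    apply/allpairsPdep; exists (a, (x + y)%N), y; rewrite mem_factor_pairs mem_iota /=.
    by split=> //; move: H; rewrite ?mulnDr; lia.
  by rewrite addnK.
- move=> [[d z] y] /allpairsPdep[[d' z'] [y' []]].
  rewrite mem_factor_pairs mem_iota /= => H1 H2 [-> -> ->].
  split=> //; last by rewrite subnK //; lia.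
  by rewrite mem_quads /=; move: H1; rewrite -mulnDr subnK; lia.
Qed.

(** When x = y the equation reads (a + b) x = n, so d = a + b is a divisor of n and b runs over 1,
    ..., d - 1. *)
Lemma sum_quads_diag_z n (F : nat -> nat -> rat) :
  \sum_(u <- quads n | u.1.2 == u.2.2) F (u.1.1 + u.2.1)%N u.2.1
  = \sum_(p <- factor_pairs n) \sum_(1 <= b < p.1) F p.1 b.
Proof.
pose T := [seq (p, b) | p <- factor_pairs n, b <- iota 1 p.1.-1].
have -> : \sum_(p <- factor_pairs n) \sum_(1 <= b < p.1) F p.1 b
    = \sum_(t <- T) F t.1.1 t.2.
  rewrite big_allpairs_dep /=; apply: eq_bigr => p _.
  by rewrite /index_iota subn1.
apply: (big_bij (h := fun u : (nat * nat) * (nat * nat) =>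
                  (((u.1.1 + u.2.1)%N, u.1.2), u.2.1))
                (k := fun t : (nat * nat) * nat =>
                  (((t.1.1 - t.2)%N, t.1.2), (t.2, t.1.2)))
                (fun t => F t.1.1 t.2)).
- exact: uniq_quads.
- exact: (uniq_dep_pairs _ (uniq_factor_pairs n)).
- move=> [[a x] [b y]]; rewrite mem_quads /= => H /eqP e; subst y; split=> //.
    apply/allpairsPdep; exists ((a + b)%N, x), b; rewrite mem_factor_pairs mem_iota /=.
    by split=> //; move: H; rewrite ?mulnDl; lia.
  by rewrite addnK.
- move=> [[d z] y] /allpairsPdep[[d' z'] [y' []]].
  rewrite mem_factor_pairs mem_iota /= => H1 H2 [-> -> ->].
  split=> //; last by rewrite subnK //; lia.
  by rewrite mem_quads /=; move: H1; rewrite -mulnDl subnK; lia.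
Qed.

(* The map (a, x, b, y) |-> (a - b, x, b, x + y) is a bijection from the
   solutions of a x + b y = n with b < a onto those with x < y. *)
Lemma sum_quads_gt n (F : nat -> nat -> rat) :
  \sum_(u <- quads n | (u.2.1 < u.1.1)%N) F u.1.1 u.2.1
  = \sum_(u <- quads n | (u.1.2 < u.2.2)%N) F (u.1.1 + u.2.1)%N u.2.1.
Proof.
rewrite -(big_bij (h := fun u : (nat * nat) * (nat * nat) =>
                  (((u.1.1 - u.2.1)%N, u.1.2), (u.2.1, (u.1.2 + u.2.2)%N)))
                (k := fun u : (nat * nat) * (nat * nat) =>
                  (((u.1.1 + u.2.1)%N, u.1.2), (u.2.1, (u.2.2 - u.1.2)%N)))
                (fun u => F (u.1.1 + u.2.1)%N u.2.1) (uniq_quads n) (uniq_quads n)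
                (P := fun u => (u.2.1 < u.1.1)%N)
                (Q := fun u => (u.1.2 < u.2.2)%N)).
- by apply: eq_bigr => u /= lt; rewrite subnK // ltnW.
- move=> [[a x] [b y]]; rewrite !mem_quads /= => /and5P[a0 x0 b0 y0 /eqP E] lt.
  split; [|by lia|by rewrite addKn subnK // ltnW].
  have -> : (((a - b) * x + b * (x + y)) = n)%N.
    by rewrite mulnDr addnA -mulnDl subnK // ltnW.
  by lia.
- move=> [[a x] [b y]]; rewrite !mem_quads /= => /and5P[a0 x0 b0 y0 /eqP E] lt.
  split; [|by lia|by rewrite addnK subnKC // ltnW].
  have -> : (((a + b) * x + b * (y - x)) = n)%N.
    by rewrite mulnDl -addnA -mulnDr subnKC // ltnW.
  by lia.
Qed.

Lemma sum_quads_swap n (P : pred ((nat * nat) * (nat * nat))) (F : _ -> rat) :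
  \sum_(u <- quads n | P u) F u
  = \sum_(u <- quads n | P (u.2, u.1)) F (u.2, u.1).
Proof.
rewrite -(big_bij (h := fun u : (nat * nat) * (nat * nat) => (u.2, u.1))
   (k := fun u : (nat * nat) * (nat * nat) => (u.2, u.1))
   F (uniq_quads n) (uniq_quads n) (P := fun u => P (u.2, u.1)) (Q := P)) //.
- by move=> [p p'] /=; rewrite !mem_quads /= addnC => /and5P[-> -> -> -> ->].
- by move=> [p p'] /=; rewrite !mem_quads /= addnC => /and5P[-> -> -> -> ->].
Qed.

Lemma sum_trichotomy (I : Type) (r : seq I) (f g : I -> nat) (F : I -> rat) :
  \sum_(i <- r) F i = \sum_(i <- r | f i == g i) F i
    + (\sum_(i <- r | (g i < f i)%N) F i + \sum_(i <- r | (f i < g i)%N) F i).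
Proof.
rewrite (bigID (fun i => f i == g i)) /=; congr (_ + _).
rewrite (bigID (fun i => (g i < f i)%N)) /=; congr (_ + _);
  by apply: eq_bigl => i; case: ltngtP.
Qed.

(** Split the first sum by comparing a with b and the second by comparing x with y. The symmetries
    of [phi] make the two off-diagonal halves of each sum equal, and [sum_quads_gt] matches the
    halves of one sum with those of the other, so only the diagonals survive. [Psi] is a discrete
    primitive of [phi] in the second argument and puts the sum over b in closed form. *)
Lemma skoruppa n (phi Psi : rat -> rat -> rat) :
    (forall a b, phi a b = phi b a) -> (forall a b, phi a b = phi a (a - b)) ->
    (forall c, Psi c 0 = 0) ->
    (forall c m, Psi c (m + 1) = Psi c m + phi c m) ->
  \sum_(u <- quads n) (phi u.1.1%:R u.2.1%:R - phi (u.1.1%:R + u.2.1%:R) u.2.1%:R)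
  = \sum_(p <- factor_pairs n) ((p.2%:R - 1) * phi p.1%:R p.1%:R
                                   - (Psi p.1%:R p.1%:R - phi p.1%:R 0)).
Proof.
move=> phiC phiB Psi0 PsiS; rewrite [LHS]sumrB [RHS]sumrB.
pose psi a b := phi (a%:R : rat) (b%:R : rat).
have psiC a b : psi a b = psi b a by rewrite /psi phiC.
have psiD a b : psi (a + b)%N a = psi (a + b)%N b.
  by rewrite /psi phiB natrD addrAC subrr add0r.
have -> : \sum_(u <- quads n) phi (u.1.1%:R + u.2.1%:R) u.2.1%:R
    = \sum_(u <- quads n) psi (u.1.1 + u.2.1)%N u.2.1.
  by apply: eq_bigr => u _; rewrite /psi natrD.
rewrite [X in X - _ = _](sum_trichotomy _ (fun u => u.1.1) (fun u => u.2.1)).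
rewrite [X in _ - X = _](sum_trichotomy _ (fun u => u.1.2) (fun u => u.2.2)).
have -> : \sum_(u <- quads n | (u.2.2 < u.1.2)%N) psi (u.1.1 + u.2.1)%N u.2.1
   = \sum_(u <- quads n | (u.1.2 < u.2.2)%N) psi (u.1.1 + u.2.1)%N u.2.1.
  rewrite sum_quads_swap; apply: eq_bigr => u _ /=.
  by rewrite addnC psiD.
have -> : \sum_(u <- quads n | (u.1.1 < u.2.1)%N) phi u.1.1%:R u.2.1%:R
   = \sum_(u <- quads n | (u.2.1 < u.1.1)%N) phi u.1.1%:R u.2.1%:R.
  by rewrite sum_quads_swap; apply: eq_bigr => u _ /=; rewrite phiC.
rewrite -(sum_quads_gt n psi) opprD addrACA subrr addr0.
rewrite sum_quads_diag_z.
have -> : \sum_(u <- quads n | u.1.1 == u.2.1) phi u.1.1%:R u.2.1%:R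
   = \sum_(u <- quads n | u.1.1 == u.2.1) psi u.1.1 u.1.1.
  by apply: eq_bigr => u /eqP e; rewrite /psi -e.
rewrite (sum_quads_diag_d n (fun a => psi a a)); congr (_ - _).
rewrite !big_seq; apply: eq_bigr => p; rewrite mem_factor_pairs => /andP[d0 _].
(* [Psi d d] sums from b = 0, the diagonal from b = 1; the term [phi d 0] is the difference. *)
have -> : Psi p.1%:R p.1%:R = \sum_(0 <= b < p.1) psi p.1 b.
  elim: {2 3}p.1 => [|m IHm]; first by rewrite Psi0 big_geq.
  by rewrite big_nat_recr //= -IHm -natr1 PsiS.
by rewrite [in RHS]big_ltn // addrAC subrr add0r.
Qed.

(** * Coefficients of Lambert series and of their products *)

Lemma coefqMn (R : comNzRingType) (f : fps R) m n : coefq (f *+ m) n = coefq f n *+ m.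
Proof. by elim: m => [|m IHm]; rewrite ?mulr0n // !mulrS coefqD IHm. Qed.

Lemma coefq_natM (R : comNzRingType) (f : fps R) m n :
  coefq (m%:R * f) n = m%:R * coefq f n.
Proof. by rewrite !mulr_natl coefqMn. Qed.

Lemma coefq_fpsC (R : comNzRingType) (c : R) (f : fps R) n :
  coefq (fpsC c * f) n = c * coefq f n.
Proof.
rewrite coefqM big_ord_recl /= subn0 big1 ?addr0 // => i _.
by rewrite mul0r.
Qed.

Lemma coefqXM (R : comNzRingType) (f : fps R) d n :
  coefq (fpsq R ^+ d * f) n = if (d <= n)%N then coefq f (n - d) else 0.
Proof.
elim: d n => [|d IHd] n; first by rewrite expr0 mul1r subn0.
rewrite exprS -mulrA coefqM big_ord_recl [coefq (fpsq R) _]/= mul0r add0r.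
case: n => [|n]; first by rewrite big_ord0.
rewrite big_ord_recl [coefq (fpsq R) _]/= mul1r lift0 subSS subn0 IHd subSS.
rewrite ltnS big1 ?addr0 // => i _.
by rewrite mul0r.
Qed.

(** The operator delta = q d/dq, which keeps the index, as opposed to d/dq. *)
Definition derivq (R : comNzRingType) (f : fps R) : fps R :=
  Fps (fun n => n%:R * coefq f n).

Lemma coefq_geom d n : (0 < d)%N ->
  coefq ('q ^+ d / (1 - 'q ^+ d)) n = ((0 < n) && (d %| n))%N%:R.
Proof.
move=> d0; pose g : fps rat := Fps (fun n => ((0 < n) && (d %| n))%N%:R).
suff -> : 'q ^+ d / (1 - 'q ^+ d) = g by [].
have u : 1 - 'q ^+ d \is a GRing.unit.
  rewrite fps_unitE coefqB -[_ ^+ d]mulr1 coefqXM.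
  by rewrite leqNgt d0 subr0 coefq1 unitr1.
apply: (mulIr u); rewrite divrK //; apply: fpsP => m.
rewrite mulrBr mulr1 coefqB [g * _]mulrC coefqXM.
rewrite -[X in coefq X m]mulr1 coefqXM coefq1 /=.
case: (leqP d m) => [le|lt]; last first.
  rewrite subr0; case: m lt => //= m lt.
  by rewrite gtnNdvd.
have [->|ne] := eqVneq m d; first by rewrite subnn d0 dvdnn.
have -> : ((m - d)%N == 0%N) = false by lia.
have -> : (0 < m)%N by lia.
have -> : (0 < m - d)%N by lia.
by rewrite dvdn_subl ?dvdnn // subrr.
Qed.

Lemma coefq_lambert k n :
  coefq (lambert k) n = \sum_(p <- factor_pairs n) p.1%:R ^+ k.
Proof.
rewrite /= /lambert_partial coefq_sum.
have -> : \sum_(1 <= d < n.+1) coefq ((d ^ k)%:R * ('q ^+ d / (1 - 'q ^+ d))) n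
   = \sum_(d <- iota 1 n | (d %| n)%N) (d%:R ^+ k : rat).
  rewrite /index_iota subn1 [RHS]big_mkcond.
  rewrite !big_seq; apply: eq_bigr => d; rewrite mem_iota => /andP[d0 dn].
  rewrite coefq_natM coefq_geom // natrX.
  have -> : (0 < n)%N by lia.
  by case: ifP; rewrite ?mulr1 ?mulr0.
apply: (big_bij (h := fun d => (d, (n %/ d)%N)) (k := fun p => p.1)
  (Q := predT) (fun p : nat * nat => p.1%:R ^+ k : rat)).
- exact: iota_uniq.
- exact: uniq_factor_pairs.
- move=> d; rewrite mem_iota mem_factor_pairs /= add1n ltnS => /andP[d0 dn] dvd.
  by rewrite mulnC divnK // eqxx divn_gt0 // d0 dn.
- move=> [d z]; rewrite mem_factor_pairs mem_iota /= => /and3P[d0 z0 /eqP <-] _.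
  by rewrite d0 dvdn_mulr // mulKn // add1n ltnS leq_pmulr.
Qed.

Lemma coefq_lambertM r s n :
  coefq (lambert r * lambert s) n
  = \sum_(u <- quads n) u.1.1%:R ^+ r * u.2.1%:R ^+ s.
Proof.
(* One box of pairs bounded by n serves every index j <= n, so the sum over j can be moved inside
   the sums over pairs, where j = p.1 p.2 is forced. *)
pose box := [seq (d, z) | d <- iota 1 n, z <- iota 1 n].
have boxE j k : (j <= n)%N -> coefq (lambert k) j
    = \sum_(p <- box | (p.1 * p.2 == j)%N) p.1%:R ^+ k.
  move=> lejn; rewrite coefq_lambert -[RHS]big_filter; apply: perm_big.
  apply: uniq_perm; rewrite ?uniq_factor_pairs ?filter_uniq ?uniq_box // => p.
  rewrite mem_factor_pairs mem_filter mem_box.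
  apply/idP/idP => [/and3P[p1 p2 e]|/andP[e /and4P[p1 _ p2 _]]].
    rewrite e p1 p2 -(eqP e) in lejn *.
    by rewrite (leq_trans _ lejn) ?leq_pmulr //= (leq_trans _ lejn) ?leq_pmull.
  by rewrite p1 p2 e.
rewrite coefqM [RHS]big_filter [RHS]big_mkcond [RHS]big_allpairs_dep.
transitivity (\sum_(j < n.+1) \sum_(p <- box | (p.1 * p.2 == j)%N)
    \sum_(p' <- box | (p'.1 * p'.2 == n - j)%N) (p.1%:R ^+ r * p'.1%:R ^+ s : rat)).
  apply: eq_bigr => j _; have := ltn_ord j; rewrite ltnS => lej.
  by rewrite !boxE ?leq_subr // big_distrlr.
under [LHS]eq_bigr do rewrite big_mkcond /=.
rewrite [LHS]exchange_big /=; apply: eq_bigr => p _.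
rewrite -[LHS]big_mkcond /=.
have [le|lt] := leqP (p.1 * p.2) n.
  rewrite (big_pred1 (Ordinal (le : p.1 * p.2 < n.+1)%N)) /= => [|j].
    rewrite big_mkcond /=; apply: eq_bigr => p' _.
    by congr (if _ then _ else _); lia.
  by apply/eqP/eqP => [e|->] //; apply: val_inj.
rewrite big_pred0 => [|j]; last by have := ltn_ord j; lia.
by rewrite big1 // => p' _; case: ifP => //; lia.
Qed.

(** * Convolution identities from invariant polynomials *)

Local Notation L1 := (lambert 1).
Local Notation L3 := (lambert 3).
Local Notation L5 := (lambert 5).
Local Notation L7 := (lambert 7).

(** A dictionary from polynomials to series: [xrs] is the coefficient of a^r b^s, hence of L_r L_s.
    As d z = n on factor pairs, a term d z d^k contributes to delta L_k (weight [yk]), and a term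
    d^k to L_k (weight [zk]). *)
Lemma skoruppa_lambert n (phi Psi : rat -> rat -> rat)
    (x11 x13 x15 x33 y1 y3 y5 z1 z3 z5 z7 : rat) :
    (forall a b, phi a b = phi b a) -> (forall a b, phi a b = phi a (a - b)) ->
    (forall c, Psi c 0 = 0) ->
    (forall c m, Psi c (m + 1) = Psi c m + phi c m) ->
    (forall a b, phi a b - phi (a + b) b
       = x11 * (a ^+ 1 * b ^+ 1) + x13 * (a ^+ 1 * b ^+ 3)
         + x13 * (a ^+ 3 * b ^+ 1) + x15 * (a ^+ 1 * b ^+ 5)
         + x15 * (a ^+ 5 * b ^+ 1) + x33 * (a ^+ 3 * b ^+ 3)) ->
    (forall d z, (z - 1) * phi d d - (Psi d d - phi d 0)
       = d * z * y1 * d ^+ 1 + d * z * y3 * d ^+ 3 + d * z * y5 * d ^+ 5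
         + z1 * d ^+ 1 + z3 * d ^+ 3 + z5 * d ^+ 5 + z7 * d ^+ 7) ->
  x11 * coefq (L1 * L1) n + x13 * coefq (L1 * L3) n + x13 * coefq (L3 * L1) n
    + x15 * coefq (L1 * L5) n + x15 * coefq (L5 * L1) n
    + x33 * coefq (L3 * L3) n
  = n%:R * y1 * coefq L1 n + n%:R * y3 * coefq L3 n + n%:R * y5 * coefq L5 n
    + z1 * coefq L1 n + z3 * coefq L3 n + z5 * coefq L5 n + z7 * coefq L7 n.
Proof.
move=> phiC phiB Psi0 PsiS phiE PsiE.
have E := skoruppa n phiC phiB Psi0 PsiS.
rewrite (eq_bigr _ (fun u _ => phiE _ _)) 5!big_split /= -!mulr_sumr in E.
rewrite !coefq_lambertM E !coefq_lambert !mulr_sumr -!big_split /= !big_seq.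
apply: eq_bigr => p; rewrite mem_factor_pairs => /and3P[_ _ /eqP <-].
by rewrite PsiE natrM.
Qed.

(** The form a^2 - a b + b^2 is invariant under (a, b) -> (b, a) and (a, b) -> (a, a - b); its
    square and cube give the next two identities. [Psi] comes from Faulhaber's formulas for the sum
    over 0 <= b < m. *)
Lemma coefq_convolution1 n :
  - (2 * coefq (L1 * L1) n)
  = n%:R * coefq L1 n - 5 / 6 * coefq L3 n - 1 / 6 * coefq L1 n.
Proof.
pose phi (a b : rat) : rat := (a ^+ 2 - a * b + b ^+ 2).
pose Psi (c m : rat) : rat :=
   c ^+ 2 * m - (1 / 2) * c * m ^+ 2 + (1 / 2) * c * m + (1 / 3) * m ^+ 3
   - (1 / 2) * m ^+ 2 + (1 / 6) * m.
unshelve epose proof (@skoruppa_lambert n phi Psi (- 2) 0 0 0 1 0 0 (- (1 / 6)) (- (5 / 6)) 0 0 _ _ _ _ _ _) as E.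
- by move=> a b; rewrite /phi; ring.
- by move=> a b; rewrite /phi; ring.
- by move=> c; rewrite /Psi; ring.
- by move=> c m; rewrite /phi /Psi; field.
- by move=> a b; rewrite /phi; ring.
- by move=> d z; rewrite /phi /Psi; field.
by move: E; lra.
Qed.

Lemma coefq_convolution2 n :
  - (4 * coefq (L1 * L3) n + 4 * coefq (L3 * L1) n)
  = n%:R * coefq L3 n - 1 / 3 * coefq L3 n - 7 / 10 * coefq L5 n
    + 1 / 30 * coefq L1 n.
Proof.
pose phi (a b : rat) : rat := (a ^+ 2 - a * b + b ^+ 2) ^+ 2.
pose Psi (c m : rat) : rat :=
   c ^+ 4 * m - c ^+ 3 * m ^+ 2 + c ^+ 3 * m + c ^+ 2 * m ^+ 3
   - (3 / 2) * c ^+ 2 * m ^+ 2 + (1 / 2) * c ^+ 2 * m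
   - (1 / 2) * c * m ^+ 4 + c * m ^+ 3 - (1 / 2) * c * m ^+ 2
   + (1 / 5) * m ^+ 5 - (1 / 2) * m ^+ 4 + (1 / 3) * m ^+ 3 - (1 / 30) * m.
unshelve epose proof (@skoruppa_lambert n phi Psi 0 (- 4) 0 0 0 1 0 (1 / 30) (- (1 / 3)) (- (7 / 10)) 0 _ _ _ _ _ _) as E.
- by move=> a b; rewrite /phi; ring.
- by move=> a b; rewrite /phi; ring.
- by move=> c; rewrite /Psi; ring.
- by move=> c m; rewrite /phi /Psi; field.
- by move=> a b; rewrite /phi; ring.
- by move=> d z; rewrite /phi /Psi; field.
by move: E; lra.
Qed.

Lemma coefq_convolution3 n :
  - (6 * coefq (L1 * L5) n + 6 * coefq (L5 * L1) n + 14 * coefq (L3 * L3) n)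
  = n%:R * coefq L5 n - 1 / 2 * coefq L5 n - 83 / 140 * coefq L7 n
    + 7 / 60 * coefq L3 n - 1 / 42 * coefq L1 n.
Proof.
pose phi (a b : rat) : rat := (a ^+ 2 - a * b + b ^+ 2) ^+ 3.
pose Psi (c m : rat) : rat :=
   c ^+ 6 * m - (3 / 2) * c ^+ 5 * m ^+ 2 + (3 / 2) * c ^+ 5 * m
   + 2 * c ^+ 4 * m ^+ 3 - 3 * c ^+ 4 * m ^+ 2 + c ^+ 4 * m
   - (7 / 4) * c ^+ 3 * m ^+ 4 + (7 / 2) * c ^+ 3 * m ^+ 3
   - (7 / 4) * c ^+ 3 * m ^+ 2 + (6 / 5) * c ^+ 2 * m ^+ 5
   - 3 * c ^+ 2 * m ^+ 4 + 2 * c ^+ 2 * m ^+ 3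
   - (1 / 5) * c ^+ 2 * m - (1 / 2) * c * m ^+ 6 + (3 / 2) * c * m ^+ 5
   - (5 / 4) * c * m ^+ 4 + (1 / 4) * c * m ^+ 2 + (1 / 7) * m ^+ 7
   - (1 / 2) * m ^+ 6 + (1 / 2) * m ^+ 5 - (1 / 6) * m ^+ 3 + (1 / 42) * m.
unshelve epose proof (@skoruppa_lambert n phi Psi 0 0 (- 6) (- 14) 0 0 1 (- (1 / 42)) (7 / 60) (- (1 / 2)) (- (83 / 140)) _ _ _ _ _ _) as E.
- by move=> a b; rewrite /phi; ring.
- by move=> a b; rewrite /phi; ring.
- by move=> c; rewrite /Psi; ring.
- by move=> c m; rewrite /phi /Psi; field.
- by move=> a b; rewrite /phi; ring.
- by move=> d z; rewrite /phi /Psi; field.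
by move: E; lra.
Qed.

(** Up to sign a b (a - b) has the same invariance, so its square qualifies. It vanishes at a = b,
    which is why no derivative term appears. The outcome amounts to E8 = E4^2. *)
Lemma coefq_convolution4 n :
  - (4 * coefq (L3 * L3) n)
  = 1 / 30 * coefq L3 n - 1 / 30 * coefq L7 n.
Proof.
pose phi (a b : rat) : rat := (a * b * (a - b)) ^+ 2.
pose Psi (c m : rat) : rat :=
   (1 / 3) * c ^+ 4 * m ^+ 3 - (1 / 2) * c ^+ 4 * m ^+ 2
   + (1 / 6) * c ^+ 4 * m - (1 / 2) * c ^+ 3 * m ^+ 4 + c ^+ 3 * m ^+ 3
   - (1 / 2) * c ^+ 3 * m ^+ 2 + (1 / 5) * c ^+ 2 * m ^+ 5
   - (1 / 2) * c ^+ 2 * m ^+ 4 + (1 / 3) * c ^+ 2 * m ^+ 3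
   - (1 / 30) * c ^+ 2 * m.
unshelve epose proof (@skoruppa_lambert n phi Psi 0 0 0 (- 4) 0 0 0 0 (1 / 30) 0 (- (1 / 30)) _ _ _ _ _ _) as E.
- by move=> a b; rewrite /phi; ring.
- by move=> a b; rewrite /phi; ring.
- by move=> c; rewrite /Psi; ring.
- by move=> c m; rewrite /phi /Psi; field.
- by move=> a b; rewrite /phi; ring.
- by move=> d z; rewrite /phi /Psi; field.
by move: E; lra.
Qed.

(** * Ramanujan's differential equations *)

Lemma coefq_derivq (R : comNzRingType) (f : fps R) n :
  coefq (derivq f) n = n%:R * coefq f n.
Proof. by []. Qed.

Lemma derivqD (R : comNzRingType) (f g : fps R) :
  derivq (f + g) = derivq f + derivq g.
Proof. by apply: fpsP => n; rewrite coefq_derivq !coefqD mulrDr. Qed.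

Lemma derivqN (R : comNzRingType) (f : fps R) : derivq (- f) = - derivq f.
Proof. by apply: fpsP => n; rewrite coefq_derivq !coefqN mulrN. Qed.

Lemma derivqM (R : comNzRingType) (f g : fps R) :
  derivq (f * g) = derivq f * g + f * derivq g.
Proof.
apply: fpsP => n; rewrite coefq_derivq coefqD !coefqM mulr_sumr -big_split.
apply: eq_bigr => j _ /=; have jn : (j <= n)%N by rewrite -ltnS.
have -> : n%:R = j%:R + (n - j)%:R :> R by rewrite -natrD subnKC.
by ring.
Qed.

Lemma derivq_nat (R : comNzRingType) m : derivq (m%:R : fps R) = 0.
Proof.
apply: fpsP => n; rewrite coefq_derivq coefqMn coefq1.
by case: n => [|n]; rewrite ?mul0r // mul0rn mulr0.
Qed.

Lemma derivq1 (R : comNzRingType) : derivq (1 : fps R) = 0.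
Proof. exact: derivq_nat 1. Qed.

Lemma derivqMnat (R : comNzRingType) (f : fps R) m :
  derivq (m%:R * f) = m%:R * derivq f.
Proof. by rewrite derivqM derivq_nat mul0r add0r. Qed.

Lemma derivqX (R : comNzRingType) (f : fps R) m :
  derivq (f ^+ m.+1) = m.+1%:R * f ^+ m * derivq f.
Proof.
elim: m => [|m IHm]; first by rewrite !mul1r.
by rewrite exprS derivqM IHm -[m.+2%:R]natr1 exprS; ring.
Qed.

Lemma lambert_ODE1 : 6 * derivq L1 = 5 * L3 + L1 - 12 * L1 ^+ 2.
Proof.
apply: fpsP => n; have := coefq_convolution1 n.
rewrite expr2 !(coefqD, coefqN, coefq_natM, coefq_derivq); lra.
Qed.

Lemma lambert_ODE3 :
  30 * derivq L3 = 21 * L5 + 10 * L3 - L1 - 240 * (L1 * L3).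
Proof.
apply: fpsP => n; have := coefq_convolution2 n; rewrite [L3 * L1]mulrC.
rewrite !(coefqD, coefqN, coefq_natM, coefq_derivq); lra.
Qed.

(** [coefq_convolution4] serves to eliminate [L7] from [coefq_convolution3]. *)
Lemma lambert_ODE5 :
  42 * derivq L5
  = 21 * L5 + 20 * L3 + L1 - 504 * (L1 * L5) + 2400 * L3 ^+ 2.
Proof.
apply: fpsP => n; have := coefq_convolution3 n; have := coefq_convolution4 n.
rewrite [L5 * L1]mulrC expr2.
rewrite !(coefqD, coefqN, coefq_natM, coefq_derivq); lra.
Qed.

(** A tool for identities modulo known relations: each use subtracts a multiple of an equation x = y
    with an explicit cofactor [c], and a final [ring] checks the polynomial identity that remains.
    The cofactors given below are thus certificates of ideal membership. *)
Lemma eq_of_multiple (R : pzRingType) (c a b x y : R) :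
  x = y -> a - b = c * (x - y) -> a = b.
Proof. by move=> ->; rewrite subrr mulr0 => /eqP; rewrite subr_eq0 => /eqP. Qed.

Definition E2 : fps rat := 1 - 24 * L1.

Lemma ramanujan_E2 : 12 * derivq E2 = E2 ^+ 2 - E4.
Proof.
rewrite /E2 /E4 derivqD derivqN derivq1 derivqMnat.
by apply: (eq_of_multiple (c := (- 48)) lambert_ODE1); ring.
Qed.

Lemma ramanujan_E4 : 3 * derivq E4 = E2 * E4 - E6.
Proof.
rewrite /E2 /E4 /E6 derivqD derivq1 derivqMnat.
by apply: (eq_of_multiple (c := 24) lambert_ODE3); ring.
Qed.

Lemma ramanujan_E6 : 2 * derivq E6 = E2 * E6 - E4 ^+ 2.
Proof.
rewrite /E2 /E4 /E6 derivqD derivqN derivq1 derivqMnat.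
by apply: (eq_of_multiple (c := (- 24)) lambert_ODE5); ring.
Qed.

(** * The logarithmic derivative of Delta and the discriminant relation *)

Lemma coefqM_trunc (R : comNzRingType) (f f' g g' : fps R) n :
    (forall i, (i <= n)%N -> coefq f i = coefq f' i) ->
    (forall i, (i <= n)%N -> coefq g i = coefq g' i) ->
  forall i, (i <= n)%N -> coefq (f * g) i = coefq (f' * g') i.
Proof.
move=> ff gg i le_in; rewrite !coefqM; apply: eq_bigr => j _.
have ji : (j <= i)%N by rewrite -ltnS.
by rewrite ff ?gg // (leq_trans _ le_in) // leq_subr.
Qed.

Lemma derivq_fpsqX d : derivq ('q ^+ d) = d%:R * 'q ^+ d.
Proof.
apply: fpsP => n; rewrite coefq_derivq coefq_natM -['q ^+ d]mulr1 coefqXM coefq1.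
case: leqP => [le|]; last by rewrite !mulr0.
have [->|ne] := eqVneq n d; first by [].
by rewrite subn_eq0 leqNgt ltn_neqAle eq_sym ne le /= !mulr0.
Qed.

(** Logarithmic derivative: q contributes 1, and each factor (1 - q^m)^24 contributes -24 m q^m / (1
    - q^m). *)
Lemma derivq_euler24_partial N :
  derivq ('q * euler24_partial N)
  = 'q * euler24_partial N * (1 - 24 * lambert_partial 1 N).
Proof.
elim: N => [|N IHN].
  rewrite /euler24_partial /lambert_partial !big_geq // mulr0 subr0 !mulr1.
  by rewrite -['q]expr1 derivq_fpsqX mul1r.
have -> : euler24_partial N.+1 = euler24_partial N * (1 - 'q ^+ N.+1) ^+ 24.
  by rewrite /euler24_partial big_nat_recr.
have -> : lambert_partial 1 N.+1 = lambert_partial 1 N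
    + N.+1%:R * ('q ^+ N.+1 / (1 - 'q ^+ N.+1)).
  by rewrite /lambert_partial big_nat_recr //= expn1.
rewrite [_ * (_ * _ ^+ 24)]mulrA derivqM IHN.
have u : 1 - 'q ^+ N.+1 \is a GRing.unit.
  rewrite fps_unitE coefqB -['q ^+ _]mulr1 coefqXM.
  by rewrite /= subr0 unitr1.
rewrite derivqX derivqD derivqN derivq1 derivq_fpsqX.
have := divrr u; set v := _^-1; set w := 'q ^+ N.+1; move: (1 - w) v => z v zv.
apply: (eq_of_multiple
  (c := 24 * 'q * euler24_partial N * z ^+ 23 * N.+1%:R * w) zv).
by ring.
Qed.

(** Coefficient n of either side involves only coefficients up to n, where the infinite product and
    the Lambert series agree with their n-th partial versions. *)
Lemma derivq_Delta : derivq Delta = Delta * E2.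
Proof.
apply: fpsP => n.
have D i : (i <= n)%N -> coefq Delta i = coefq ('q * euler24_partial n) i.
  apply: coefqM_trunc => // j jn.
  by rewrite (euler24_cvg jn).
rewrite coefq_derivq D // -coefq_derivq derivq_euler24_partial.
apply/esym; apply: (coefqM_trunc D) => // i le_in.
rewrite !coefqB !coefq_natM; congr (_ - _ * _).
by rewrite (lambert_cvg 1 le_in).
Qed.

Lemma coefq_Delta0 : coefq Delta 0 = 0.
Proof. by rewrite coefq0M mul0r. Qed.

Lemma coefq_Delta1 : coefq Delta 1 = 1.
Proof. by rewrite /Delta -['q]expr1 coefqXM /= /euler24_partial big_geq.
Qed.

Lemma coefq_lambert1 k : coefq (lambert k) 1 = 1.
Proof.
by rewrite coefq_lambert /factor_pairs /= big_cons big_nil expr1n addr0.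
Qed.

Lemma coefq01 (R : comNzRingType) (f g : fps R) :
  coefq (f * g) 1 = coefq f 0 * coefq g 1 + coefq f 1 * coefq g 0.
Proof. by rewrite coefqM big_ord_recl big_ord1. Qed.

(** Comparing coefficients expresses (n - 1) f_n through the f_j with j < n. The factor n - 1
    vanishes at n = 1, whence the separate assumption on [coefq f 1]. *)
Lemma derivq_linear_eq0 (f e : fps rat) :
    derivq f = f * e -> coefq e 0 = 1 -> coefq f 0 = 0 -> coefq f 1 = 0 ->
  f = 0.
Proof.
move=> df e0 f0 f1; apply: fpsP => n; rewrite coefq0.
elim/ltn_ind: n => -[//|[//|n IHn]].
have := congr1 (fun f => coefq f n.+2) df.
rewrite coefq_derivq coefqM big_ord_recr /= subnn e0 mulr1.
rewrite big1 ?add0r => [/eqP|[i ltin] _]; last by rewrite IHn ?mul0r.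
rewrite -subr_eq0 -[X in _ - X]mul1r -mulrBl mulf_eq0 => /orP[|/eqP//].
by rewrite -natr1 addrK pnatr_eq0.
Qed.

Lemma coefq_cube_sub_square (R : comNzRingType) (f g h : fps R) m :
    coefq f 0 = 1 -> coefq g 0 = 1 -> coefq h 0 = 0 ->
  (coefq (f ^+ 3 - g ^+ 2 - m%:R * h) 0 = 0) *
  (coefq (f ^+ 3 - g ^+ 2 - m%:R * h) 1
   = 3 * coefq f 1 - 2 * coefq g 1 - m%:R * coefq h 1).
Proof.
move=> f0 g0 h0; rewrite !coefqB !coefq_natM !exprS !expr0 !mulr1.
by rewrite !coefq01 !coefq0M f0 g0 h0; split; ring.
Qed.

Lemma coefq_E4_0 : coefq E4 0 = 1.
Proof. by rewrite coefqD coefq_natM coefq1 lambert_coef0 mulr0 addr0. Qed.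

Lemma coefq_E6_0 : coefq E6 0 = 1.
Proof. by rewrite coefqB coefq_natM coefq1 lambert_coef0 mulr0 subr0. Qed.

Lemma coefq_E2_0 : coefq E2 0 = 1.
Proof. by rewrite coefqB coefq_natM coefq1 lambert_coef0 mulr0 subr0. Qed.

(** Both sides solve delta f = f E2, so it suffices to compare the coefficients of 1 and q; at q
    this is 3 * 240 + 2 * 504 = 1728. *)
Lemma Delta_E4_E6 : 1728 * Delta = E4 ^+ 3 - E6 ^+ 2.
Proof.
apply/esym/eqP; rewrite -subr_eq0; apply/eqP; apply: (derivq_linear_eq0 (e := E2)).
- rewrite !derivqD !derivqN derivqMnat !derivqX derivq_Delta.
  apply: (eq_of_multiple (c := E4 ^+ 2) ramanujan_E4).
  apply: (eq_of_multiple (c := - E6) ramanujan_E6).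
  by ring.
- exact: coefq_E2_0.
- by rewrite (coefq_cube_sub_square _ coefq_E4_0 coefq_E6_0 coefq_Delta0).
rewrite (coefq_cube_sub_square _ coefq_E4_0 coefq_E6_0 coefq_Delta0).
rewrite coefq_Delta1 coefqD coefqB !coefq_natM !coefq_lambert1 coefq1 /=.
by ring.
Qed.
(** * Composition of power series *)

Lemma sum_triangle (V : nmodType) n (F : nat -> nat -> V) :
    (forall i j, (n < i + j)%N -> F i j = 0) ->
  \sum_(m < n.+1) \sum_(i < m.+1) F i (m - i)%N
  = \sum_(i < n.+1) \sum_(j < n.+1) F i j.
Proof.
move=> F0.
under eq_bigr => m _ do
  rewrite (big_ord_widen n.+1 (fun i => F i (m - i)%N)) // ?ltn_ord //.
rewrite (exchange_big_dep predT) //=; apply: eq_bigr => i _.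
have le_i : (i <= n.+1)%N by rewrite ltnW.
rewrite -(big_mkord (fun m => i < m.+1)%N (fun m => F i (m - i)%N)).
rewrite -(big_mkord predT (F i)).
rewrite (@big_cat_nat _ _ _ i) ?le_i //= big_nat_cond big_pred0 => [|m]; last by lia.
rewrite add0r -{1}[nat_of_ord i]add0n big_addn.
rewrite [RHS](@big_cat_nat _ _ _ (n.+1 - i)) ?leq_subr //=.
rewrite [X in _ = _ + X]big_nat_cond [X in _ = _ + X]big1 ?addr0 => [|j]; last first.
  by move=> H; apply: F0; lia.
rewrite [LHS]big_nat_cond [RHS]big_nat_cond.
by apply: eq_big => [j|j _]; rewrite ?addnK //; lia.
Qed.

Section Composition.
Variables (R : comNzRingType) (t : fps R).
Hypothesis t0 : coefq t 0 = 0.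
Implicit Types c d : fps R.

(** The series c(t). Stopping at i = n is legitimate because t^i starts at q^i or later when t has
    no constant term. *)
Definition fps_comp c : fps R :=
  Fps (fun n => \sum_(i < n.+1) coefq c i * coefq (t ^+ i) n).

Lemma coefq_fps_comp c n N : (n <= N)%N ->
  coefq (fps_comp c) n = \sum_(i < N.+1) coefq c i * coefq (t ^+ i) n.
Proof.
move=> /subnKC <-; elim: (N - n)%N => [|d IHd]; first by rewrite addn0.
rewrite IHd addnS [RHS]big_ord_recr /= -[LHS]addr0; congr (_ + _).
by rewrite (qdvdX t0) ?mulr0 // ltnS leq_addr.
Qed.

Lemma fps_compD c d : fps_comp (c + d) = fps_comp c + fps_comp d.
Proof.
apply: fpsP => n; rewrite coefqD /= -big_split /=.
by apply: eq_bigr => i _; rewrite mulrDl.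
Qed.

Lemma fps_compN c : fps_comp (- c) = - fps_comp c.
Proof.
by apply: fpsP => n; rewrite coefqN /= -sumrN; apply: eq_bigr => i _; rewrite mulNr.
Qed.

Lemma fps_comp_fpsC a : fps_comp (fpsC a) = fpsC a.
Proof.
apply: fpsP => n /=; rewrite big_ord_recl big1 ?addr0 => [|i _]; last by rewrite mul0r.
by rewrite coefq1 /=; case: n => [|n]; rewrite ?mulr1 ?mulr0.
Qed.

Lemma fps_comp1 : fps_comp 1 = 1.
Proof. exact: fps_comp_fpsC 1. Qed.

Lemma fps_comp_fpsq : fps_comp (fpsq R) = t.
Proof.
apply: fpsP => n; rewrite (coefq_fps_comp _ (leqnSn n)).
rewrite !big_ord_recl big1 => [|i _]; last by rewrite mul0r.
by rewrite [coefq _ _]/= mul0r add0r addr0 /= mul1r.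
Qed.

Lemma coefq_fps_compMr c f n :
  coefq (fps_comp c * f) n = \sum_(i < n.+1) coefq c i * coefq (t ^+ i * f) n.
Proof.
rewrite coefqM.
under eq_bigr => j _.
  rewrite (coefq_fps_comp c (n := j) (N := n)); last by rewrite -ltnS.
  rewrite mulr_suml.
  over.
rewrite exchange_big /=; apply: eq_bigr => i _.
by rewrite mulr_sumr; apply: eq_bigr => j _; rewrite mulrA.
Qed.

(** Both sides are sums of c_i d_j [q^n] t^(i+j), one over i + j <= n and the other over the square
    i, j <= n; the extra terms vanish since t^(i+j) is divisible by q^(i+j). *)
Lemma fps_compM c d : fps_comp (c * d) = fps_comp c * fps_comp d.
Proof.
apply: fpsP => n; rewrite coefq_fps_compMr.
under eq_bigr => i _.
  rewrite [t ^+ i * _]mulrC coefq_fps_compMr.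
  under eq_bigr => j _ do rewrite -exprD addnC.
  over.
rewrite [LHS]/=.
under eq_bigr => m _ do rewrite mulr_suml.
pose F i j := coefq c i * (coefq d j * coefq (t ^+ (i + j)) n).
transitivity (\sum_(m < n.+1) \sum_(i < m.+1) F i (m - i)%N).
  apply: eq_bigr => m _; apply: eq_bigr => i _.
  by rewrite /F mulrA subnKC // -ltnS.
rewrite sum_triangle => [|a b lt]; last by rewrite /F (qdvdX t0) ?mulr0.
by apply: eq_bigr => i _; rewrite mulr_sumr.
Qed.

Definition formal_deriv c : fps R := Fps (fun n => n.+1%:R * coefq c n.+1).

Lemma fpsq_formal_deriv c : fpsq R * formal_deriv c = derivq c.
Proof.
apply: fpsP => n; rewrite -[fpsq R]expr1 coefqXM coefq_derivq.
by case: n => [|n]; rewrite ?mul0r //= subn1.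
Qed.

Lemma derivq_fps_comp c :
  derivq (fps_comp c) = fps_comp (formal_deriv c) * derivq t.
Proof.
apply: fpsP => n; rewrite coefq_fps_compMr coefq_derivq.
rewrite (coefq_fps_comp _ (leqnSn n)) mulr_sumr.
under eq_bigr do rewrite mulrCA -coefq_derivq.
rewrite big_ord_recl expr0 derivq1 coefq0 mulr0 add0r.
apply: eq_bigr => i _; rewrite lift0 derivqX -mulrA coefq_natM.
by rewrite [coefq (formal_deriv c) i]/= mulrCA mulrA.
Qed.

Lemma coefq0_fps_comp c : coefq (fps_comp c) 0 = coefq c 0.
Proof. by rewrite /= big_ord1 expr0 coefq1 mulr1. Qed.

Lemma fps_compMnat m c : fps_comp (m%:R * c) = m%:R * fps_comp c.
Proof.
apply: fpsP => n; rewrite coefq_natM /= mulr_sumr.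
by apply: eq_bigr => i _; rewrite mulrA -coefq_natM.
Qed.

End Composition.

(** * Binomial and hypergeometric series *)

(* The series of (1 - 4 r x)^(-1/2). *)
Definition central_binom_series (r : rat) : fps rat :=
  Fps (fun m => 'C(m.*2, m)%:R * r ^+ m).

Lemma central_binomS m : (m.+1 * 'C(m.+1.*2, m.+1) = 2 * (m.*2.+1 * 'C(m.*2, m)))%N.
Proof.
have := mul_bin_diag m.*2.+2 m; have := mul_bin_down m.*2.+1 m.
rewrite /= doubleS (_ : (m.*2.+1 - m)%N = m.+1); last by lia.
by move=> E1 <-; rewrite E1 -!muln2; ring.
Qed.

Lemma derivq_fpsC (R : comNzRingType) (c : R) : derivq (fpsC c) = 0.
Proof.
by apply: fpsP => -[|n]; rewrite coefq_derivq ?mul0r // mulr0.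
Qed.

Lemma derivq_eq0 (f : fps rat) : derivq f = 0 -> f = fpsC (coefq f 0).
Proof.
move=> df; apply: fpsP => -[//|n]; have := congr1 (fun f => coefq f n.+1) df.
by rewrite coefq_derivq => /eqP; rewrite mulf_eq0 pnatr_eq0 => /eqP.
Qed.

(** This is the recurrence [central_binomS] read as (1 - 4 r x) delta B = 2 r x B. *)
Lemma central_binom_ODE r :
  derivq (central_binom_series r)
  = 4 * fpsC r * 'q * derivq (central_binom_series r)
    + 2 * fpsC r * 'q * central_binom_series r.
Proof.
apply: fpsP => n; rewrite -['q]expr1 -!mulrA coefqD !coefq_natM !coefq_fpsC !coefqXM.
case: n => [|n]; first by rewrite coefq_derivq /= mul0r !mulr0 addr0.
rewrite !coefq_derivq /= subn1 /= exprS.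
have E : n.+1%:R * 'C(n.+1.*2, n.+1)%:R
    = 2 * ((2 * n%:R + 1) * 'C(n.*2, n)%:R) :> rat.
  by rewrite -!natrM natr1 -!natrM central_binomS -!mul2n.
transitivity (r * r ^+ n * (n.+1%:R * 'C(n.+1.*2, n.+1)%:R)).
  by ring.
by rewrite E; ring.
Qed.

(** By the differential equation delta kills the left side, which therefore equals its constant
    term. *)
Lemma central_binom_square r :
  central_binom_series r ^+ 2 * (1 - 4 * fpsC r * 'q) = 1.
Proof.
set B := central_binom_series r.
have B0 : coefq (B ^+ 2 * (1 - 4 * fpsC r * 'q)) 0 = 1.
  rewrite expr2 2!coefq0M coefqB coefq0M coefq1 [coefq 'q 0]/= mulr0 subr0.
  by rewrite /B /= !mulr1.
transitivity (fpsC 1 : fps rat) => //.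
rewrite -[in RHS]B0; apply: derivq_eq0.
have dq : derivq 'q = 'q by rewrite -[LHS]/(derivq ('q ^+ 1)) derivq_fpsqX mul1r.
rewrite expr2 derivqM derivqD derivq1 derivqN !derivqM derivq_fpsC derivq_nat dq.
apply: (eq_of_multiple (c := 2 * B) (central_binom_ODE r)).
by rewrite -/B; ring.
Qed.

Lemma fps_unit1 (f : fps rat) : coefq f 0 = 1 -> f \is a GRing.unit.
Proof. by rewrite fps_unitE => ->; rewrite unitr1. Qed.

Lemma fps_sqrt_unique (f g : fps rat) :
  coefq f 0 = 1 -> coefq g 0 = 1 -> f ^+ 2 = g ^+ 2 -> f = g.
Proof.
move=> f0 g0 /eqP; rewrite -subr_eq0 subr_sqr => /eqP fg.
have u : f + g \is a GRing.unit by rewrite fps_unitE coefqD f0 g0.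
by apply/eqP; rewrite -subr_eq0; apply/eqP/(mulIr u); rewrite fg mul0r.
Qed.

(* The coefficient of x^k in 3F2(1/6, 1/2, 5/6; 1, 1; 1728 x), which is
   E4^(1/2) at x = Delta / E4^3. *)
Definition sqrtE4_coef (k : nat) : rat :=
  (6 * k)%N`!%:R / ((3 * k)%N`! * k`! ^ 3)%N%:R.

(** The polynomial is 24 (2k + 1) (6k + 1) (6k + 5), which remains after cancelling in the ratio of
    consecutive coefficients; it is expanded so as to be read as a differential operator. *)
Lemma sqrtE4_coefS k :
  k.+1%:R ^+ 3 * sqrtE4_coef k.+1
  = (1728 * k%:R ^+ 3 + 2592 * k%:R ^+ 2 + 1104 * k%:R + 120) * sqrtE4_coef k.
Proof.
have pos m : m%:R + 1 != 0 :> rat by rewrite natr1 pnatr_eq0.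
have pos3 j : 3 * k%:R + j.+1%:R != 0 :> rat.
  by rewrite -natrM -natrD pnatr_eq0 addnS.
have fact_neq0 m : m`!%:R != 0 :> rat by rewrite pnatr_eq0 -lt0n fact_gt0.
have E6 : (6 * k.+1)%N`!%:R = (6 * k%:R + 6) * ((6 * k%:R + 5) * ((6 * k%:R + 4)
    * ((6 * k%:R + 3) * ((6 * k%:R + 2) * ((6 * k%:R + 1) * (6 * k)%N`!%:R))))) :> rat.
  by rewrite mulnS !addSn add0n !factS !natrM -!natr1 natrM; ring.
have E3 : (3 * k.+1)%N`!%:R = (3 * k%:R + 3) * ((3 * k%:R + 2)
    * ((3 * k%:R + 1) * (3 * k)%N`!%:R)) :> rat.
  by rewrite mulnS !addSn add0n !factS !natrM -!natr1 natrM; ring.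
rewrite /sqrtE4_coef E6 ![(_ * _ ^ 3)%N%:R]natrM ![(_ ^ 3)%N%:R]natrX E3.
rewrite [k.+1`!]factS [(k.+1 * _)%N%:R]natrM -natr1.
by field; rewrite !fact_neq0 pos (pos3 0%N) (pos3 1%N) (pos3 2%N).
Qed.
(** * The square root of E4 *)

Lemma derivqV (f : fps rat) : f \is a GRing.unit ->
  derivq f^-1 = - (f^-1 ^+ 2 * derivq f).
Proof.
move=> uf; apply: (mulrI uf).
have := derivq1 rat; rewrite -(divrr uf) derivqM addrC => /eqP.
rewrite addr_eq0 => /eqP ->; rewrite mulrN; congr (- _).
by rewrite expr2 !mulrA divrr // mul1r mulrC.
Qed.

Definition hauptmodul : fps rat := Delta / E4 ^+ 3.
Local Notation t := hauptmodul.

Lemma hauptmodul_E4 : t * E4 ^+ 3 = Delta.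
Proof. by rewrite divrK // unitrX // E4_unit. Qed.

Lemma coefq_hauptmodul0 : coefq t 0 = 0.
Proof. by rewrite coefq0M coefq_Delta0 mul0r. Qed.

(** The logarithmic derivative of Delta / E4^3 is E2 - 3 delta E4 / E4 = E6 / E4. *)
Lemma derivq_hauptmodul : E4 * derivq t = t * E6.
Proof.
have u : E4 ^+ 2 \is a GRing.unit by rewrite unitrX // E4_unit.
apply: (mulIr u); have := derivq_Delta.
rewrite -hauptmodul_E4 derivqM derivqX => dD.
apply: (eq_of_multiple (c := 1) dD).
apply: (eq_of_multiple (c := - (t * E4 ^+ 2)) ramanujan_E4).
by ring.
Qed.

Definition theta (f : fps rat) : fps rat := E4 / E6 * derivq f.

Lemma thetaD f g : theta (f + g) = theta f + theta g.
Proof. by rewrite /theta derivqD mulrDr. Qed.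

Lemma thetaN f : theta (- f) = - theta f.
Proof. by rewrite /theta derivqN mulrN. Qed.

Lemma thetaM f g : theta (f * g) = theta f * g + f * theta g.
Proof. by rewrite /theta derivqM; ring. Qed.

(** Since theta = t d/dt, a differential equation in theta for c(t) becomes a recurrence for the
    coefficients of c. *)
Lemma theta_fps_comp c : theta (fps_comp t c) = fps_comp t (derivq c).
Proof.
rewrite -fpsq_formal_deriv fps_compM ?fps_comp_fpsq ?coefq_hauptmodul0 //.
rewrite /theta derivq_fps_comp ?coefq_hauptmodul0 //.
have -> : E4 / E6 * (fps_comp t (formal_deriv c) * derivq t)
    = E4 * derivq t / E6 * fps_comp t (formal_deriv c) by ring.
by rewrite derivq_hauptmodul mulrK ?E6_unit.
Qed.

Lemma fps_natI m (f g : fps rat) : (0 < m)%N -> m%:R * f = m%:R * g -> f = g.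
Proof.
move=> m0 e; apply: fpsP => n; have := congr1 (fun h => coefq h n) e.
by rewrite !coefq_natM => /mulfI; apply; rewrite pnatr_eq0 -lt0n.
Qed.

(** To be used with D = theta, f = E4^(1/2), w = E2 E4 / E6 and X = E4^3 / E6^2, on which
    Ramanujan's equations close up; eliminating w yields an equation of third order. With an
    abstract derivation the elimination is plain polynomial algebra. *)
Lemma derivation_ODE3 (S : comNzRingType) (D : S -> S) (f w X : S) :
    {morph D : x y / x + y} -> (forall x y, D (x * y) = D x * y + x * D y) ->
    6 * D f = f * (w - 1) -> 12 * D w = - w ^+ 2 - 4 * w + X * (6 * w - 1) ->
    D X = X ^+ 2 - X ->
  864 * D (D (D f)) = (X - 1) * (1296 * D (D f) + 552 * D f + 60 * f).
Proof.
move=> DD DM E1 EW EX.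
have D0 : D 0 = 0 by apply: (addrI (D 0)); rewrite -DD !addr0.
have D1 : D 1 = 0.
  by apply: (addrI (D 1)); rewrite addr0 -{3}[1]mulr1 DM mulr1 mul1r.
have DN x : D (- x) = - D x.
  by apply: (addrI (D x)); rewrite -DD !subrr.
have DMn m x : D (m%:R * x) = m%:R * D x.
  by rewrite !mulr_natl; elim: m => [|m IHm]; rewrite ?mulr0n // !mulrS DD IHm.
have E2 : 6 * D (D f) = D f * (w - 1) + f * D w.
  by rewrite -DMn E1 DM DD DN D1 subr0.
have E3 : 6 * D (D (D f)) = D (D f) * (w - 1) + 2 * D f * D w + f * D (D w).
  by rewrite -DMn E2 DD !DM DD DN D1; ring.
have EW2 : 12 * D (D w) = - (2 * w * D w) - 4 * D w
    + D X * (6 * w - 1) + 6 * X * D w.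
  rewrite -DMn EW !DD !DN DMn expr2 !DM.
  by rewrite DD DMn DN D1; ring.
(* The cofactors eliminate in turn D^3 f, D^2 f, D^2 w, D f, D X and D w. *)
apply: (eq_of_multiple (c := 144) E3).
apply: (eq_of_multiple (c := 24 * (w - 1) - 216 * (X - 1)) E2).
apply: (eq_of_multiple (c := 12 * f) EW2).
apply: (eq_of_multiple (c := 48 * D w + 4 * (w - 1) ^+ 2
                             - 36 * (X - 1) * (w - 1) - 92 * (X - 1)) E1).
apply: (eq_of_multiple (c := 12 * f * (6 * w - 1)) EX).
apply: (eq_of_multiple (c := (2 * (w - 1) - 18 * (X - 1) + 4 * (w - 1)
                             + (6 * X - 2 * w - 4)) * f) EW).
by ring.
Qed.

Section SqrtE4.
Variable f : fps rat.
Hypotheses (f0 : coefq f 0 = 1) (f2 : f ^+ 2 = E4).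

Let r := E6^-1.
Let rE6 : r * E6 = 1. Proof. by rewrite mulVr ?E6_unit. Qed.
Let w := E2 * E4 * r.
Let X := E4 ^+ 3 * r ^+ 2.

Lemma theta_sqrtE4 : 6 * theta f = f * (w - 1).
Proof.
apply: (mulrI (fps_unit1 f0)); rewrite /theta -/r /w.
have df : 2 * f * derivq f = derivq E4 by rewrite -f2 derivqX expr1.
apply: (eq_of_multiple (c := 3 * E4 * r) df).
apply: (eq_of_multiple (c := E4 * r) ramanujan_E4).
apply: (eq_of_multiple (c := - (E2 * E4 * r - 1)) f2).
apply: (eq_of_multiple (c := - E4) rE6).
by ring.
Qed.

Let dr : derivq r = - (r ^+ 2 * derivq E6).
Proof. by rewrite derivqV ?E6_unit. Qed.

Lemma theta_w : 12 * theta w = - w ^+ 2 - 4 * w + X * (6 * w - 1).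
Proof.
rewrite /theta -/r /w !derivqM dr /X.
apply: (eq_of_multiple (c := E4 ^+ 2 * r ^+ 2) ramanujan_E2).
apply: (eq_of_multiple (c := 4 * E2 * E4 * r ^+ 2) ramanujan_E4).
apply: (eq_of_multiple (c := - (6 * E2 * E4 ^+ 2 * r ^+ 3)) ramanujan_E6).
apply: (eq_of_multiple (c := - (6 * E2 ^+ 2 * E4 ^+ 2 * r ^+ 2 + 4 * E2 * E4 * r)) rE6).
by ring.
Qed.

Lemma theta_X : theta X = X ^+ 2 - X.
Proof.
rewrite /theta -/r /X derivqM !derivqX dr.
apply: (eq_of_multiple (c := E4 ^+ 3 * r ^+ 3) ramanujan_E4).
apply: (eq_of_multiple (c := - (E4 ^+ 4 * r ^+ 4)) ramanujan_E6).
apply: (eq_of_multiple (c := - (E2 * E4 ^+ 4 * r ^+ 3 + E4 ^+ 3 * r ^+ 2)) rE6).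
by ring.
Qed.

Lemma X_hauptmodul : X * (1 - 1728 * t) = 1.
Proof.
have u : E4 ^+ 3 \is a GRing.unit by rewrite unitrX // E4_unit.
apply: (mulIr u); rewrite /X.
apply: (eq_of_multiple (c := - (1728 * (E4 ^+ 3 * r ^+ 2))) hauptmodul_E4).
apply: (eq_of_multiple (c := - (E4 ^+ 3 * r ^+ 2)) Delta_E4_E6).
apply: (eq_of_multiple (c := E4 ^+ 3 * (r * E6 + 1)) rE6).
by ring.
Qed.

Lemma theta3_sqrtE4_X :
  864 * theta (theta (theta f))
  = (X - 1) * (1296 * theta (theta f) + 552 * theta f + 60 * f).
Proof.
exact: (derivation_ODE3 thetaD thetaM theta_sqrtE4 theta_w theta_X).
Qed.

(** Multiplying the previous equation by 1 - 1728 t = 1/X turns X - 1 into 1728 t; the common factor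
    864 is then cancelled. *)
Lemma theta3_sqrtE4 :
  theta (theta (theta f))
  = t * (1728 * theta (theta (theta f)) + 2592 * theta (theta f)
         + 1104 * theta f + 120 * f).
Proof.
apply: (@fps_natI 864) => //.
apply: (eq_of_multiple (c := 1 - 1728 * t) theta3_sqrtE4_X).
apply: (eq_of_multiple
  (c := 1296 * theta (theta f) + 552 * theta f + 60 * f) X_hauptmodul).
by ring.
Qed.

End SqrtE4.

Lemma coefq_theta f n : qdvd n f -> coefq (theta f) n = n%:R * coefq f n.
Proof.
move=> fn; have e0 : coefq (E4 / E6) 0 = 1.
  rewrite -[LHS]mulr1 -coefq_E6_0 -coefq0M divrK ?E6_unit //.
  by rewrite coefq_E4_0 coefq_E6_0.
rewrite coefqM big_ord_recl e0 mul1r subn0 coefq_derivq big1 ?addr0 // => i _.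
by rewrite lift0 coefq_derivq fn ?mulr0 //; have := ltn_ord i; lia.
Qed.

Lemma qdvd_theta f n : qdvd n f -> qdvd n (theta f).
Proof. by move=> fn; apply: qdvdMl => i lt; rewrite coefq_derivq fn // mulr0. Qed.

Lemma qdvdD (f g : fps rat) n : qdvd n f -> qdvd n g -> qdvd n (f + g).
Proof. by move=> fn gn i lt; rewrite coefqD fn // gn // addr0. Qed.

Lemma coefq_hauptmodulM f n : qdvd n f -> coefq (t * f) n = 0.
Proof.
move=> fn; rewrite coefqM big_ord_recl coefq_hauptmodul0 mul0r add0r.
rewrite big1 // => i _; rewrite lift0 fn ?mulr0 //; have := ltn_ord i; lia.
Qed.

Definition sqrtE4_operator (f : fps rat) : fps rat :=
  1728 * theta (theta (theta f)) + 2592 * theta (theta f)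
  + 1104 * theta f + 120 * f.

(** If f vanishes below q^(n+1), then theta multiplies its coefficient of q^(n+1) by n + 1 and the
    factor t kills the right side there, leaving (n + 1)^3 f_(n+1) = 0. *)
Lemma theta3_unique (f : fps rat) :
    theta (theta (theta f)) = t * sqrtE4_operator f -> coefq f 0 = 0 -> f = 0.
Proof.
move=> ODE f0; apply: fpsP => n; rewrite coefq0; elim/ltn_ind: n => n IHn.
case: n IHn => [//|n] IHn.
have d0 : qdvd n.+1 f by move=> i; apply: IHn.
have d1 := qdvd_theta d0; have d2 := qdvd_theta d1; have d3 := qdvd_theta d2.
have := congr1 (fun h => coefq h n.+1) ODE.
rewrite coefq_hauptmodulM; last by do 3?apply: qdvdD; apply: qdvdMl.
rewrite !coefq_theta // => /eqP; rewrite !mulf_eq0 pnatr_eq0 /=.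
by move/eqP.
Qed.

Definition sqrtE4_series : fps rat := Fps sqrtE4_coef.

Lemma derivq3_sqrtE4_series (c := sqrtE4_series) :
  derivq (derivq (derivq c))
  = 'q * (1728 * derivq (derivq (derivq c)) + 2592 * derivq (derivq c)
          + 1104 * derivq c + 120 * c).
Proof.
apply: fpsP => n; rewrite -['q]expr1 coefqXM !coefqD !coefq_natM !coefq_derivq.
case: n => [|n]; first by rewrite [LHS]mul0r.
rewrite /= subn1 [n.+1.-1]/=; have := sqrtE4_coefS n.
move: (sqrtE4_coef n.+1) (sqrtE4_coef n) => x y E.
by apply: (eq_of_multiple (c := 1) E); ring.
Qed.

Lemma sqrtE4_comp (f : fps rat) : coefq f 0 = 1 -> f ^+ 2 = E4 ->
  f = fps_comp t sqrtE4_series.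
Proof.
move=> f0 f2; apply/eqP; rewrite -subr_eq0; apply/eqP; apply: theta3_unique.
  have H := theta3_sqrtE4 f0 f2.
  have := congr1 (fps_comp t) derivq3_sqrtE4_series.
  rewrite fps_compM ?fps_comp_fpsq ?coefq_hauptmodul0 //.
  rewrite !fps_compD !fps_compMnat -!theta_fps_comp => H'.
  rewrite /sqrtE4_operator !(thetaD, thetaN).
  apply: (eq_of_multiple (c := 1) H); apply: (eq_of_multiple (c := - 1) H').
  by ring.
rewrite coefqB f0 coefq0_fps_comp /= /sqrtE4_coef.
by rewrite !muln0 fact0 exp1n mul1n divr1 subrr.
Qed.
(** * Divisibility *)

(** Legendre's formula with a free upper limit, so that the sums for several factorials run over one
    range and compare term by term. *)
Lemma logn_fact_bound p n K : prime p -> (n < K)%N ->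
  logn p n`! = (\sum_(1 <= e < K) n %/ p ^ e)%N.
Proof.
move=> pr_p nK; rewrite logn_fact //.
rewrite [RHS](@big_cat_nat _ _ _ n.+1) //= [X in (_ + X)%N]big_nat_cond.
rewrite [X in (_ + X)%N]big1 ?addn0 // => e /andP[/andP[ne _] _].
by rewrite divn_small // (ltn_trans ne) // ltn_expl // prime_gt1.
Qed.

(** The first quotient on the left exceeds (r + s) / M only if r + s + 1 = M. Then 6 r < M and 2 s <
    M cannot both hold, so another floor supplies the missing unit, while 3 r / M is absorbed by
    twice itself being at most 6 r / M. *)
Lemma floor_ineq M r s : (1 < M)%N -> (r < M)%N -> (s < M)%N ->
  ((r + s).+1 %/ M + 3 * r %/ M <= (r + s) %/ M + 6 * r %/ M + 2 * s %/ M)%N.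
Proof.
move=> M1 rM sM; have M0 : (0 < M)%N by lia.
have le36 : (3 * r %/ M + 3 * r %/ M <= 6 * r %/ M)%N.
  by rewrite leq_divRL //; have := leq_trunc_div (3 * r) M; lia.
have [e|ne] := eqVneq (r + s).+1 M; last first.
  have -> : ((r + s).+1 %/ M = (r + s) %/ M)%N.
    have [lt|ge] := ltnP (r + s) M.
      by rewrite !divn_small //; lia.
    have q1 x : (M <= x)%N -> (x < M + M)%N -> (x %/ M = 1)%N.
      move=> Mx x2; rewrite -(subnKC Mx) divnDl ?dvdnn // divnn M0 divn_small //.
      by lia.
    by rewrite !q1 //; lia.
  by rewrite -addnA leq_add2l (leq_trans _ (leq_addr _ _)) // (leq_trans _ le36) ?leq_addr.
rewrite e divnn M0.
have : (1 <= 3 * r %/ M)%N || ((1 <= 6 * r %/ M)%N || (1 <= 2 * s %/ M)%N).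
  by rewrite !leq_divRL //; lia.
move: le36; clear; move: (3 * r %/ M)%N (6 * r %/ M)%N (2 * s %/ M)%N ((r + s) %/ M)%N.
by lia.
Qed.

(** Division with remainder of k and m by M adds 7 (k / M) + 3 (m / M) to both sides of
    [floor_ineq]. *)
Lemma floor_ineq_gen M k m : (1 < M)%N ->
  ((k + m).+1 %/ M + (3 * k %/ M + 3 * (k %/ M) + 2 * (m %/ M))
   <= (k + m) %/ M + (6 * k %/ M + 2 * m %/ M))%N.
Proof.
move=> M1; have M0 : (0 < M)%N by lia.
have H := floor_ineq M1 (ltn_pmod k M0) (ltn_pmod m M0).
move: (k %/ M)%N (m %/ M)%N (divn_eq k M) (divn_eq m M) => a b ek em.
move: (k %% M)%N (m %% M)%N ek em H => r s -> -> H.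
have -> : (a * M + r + (b * M + s) = (a + b) * M + (r + s))%N by ring.
rewrite -addnS.
have E c : (c * (a * M + r) = c * a * M + c * r)%N by ring.
have E' c : (c * (b * M + s) = c * b * M + c * s)%N by ring.
rewrite !E !E' !divnMDl //; lia.
Qed.

(** Multiplying by (k + m)! turns the factor k + m + 1 into (k + m + 1)!, so Legendre's formula
    applies throughout, and [floor_ineq_gen] compares the contributions of each prime power M =
    p^e. *)
Lemma fact_quotient_dvd k m :
  ((k + m).+1 * ((3 * k)`! * k`! ^ 3 * m`! ^ 2) %| (6 * k)`! * (2 * m)`!)%N.
Proof.
rewrite -(@dvdn_pmul2l (k + m)`!) ?fact_gt0 // mulnA -[(_`! * _.+1)%N]mulnC -factS.
have pos n : (0 < n`!)%N := fact_gt0 n.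
apply/dvdn_partP; first by rewrite !muln_gt0 ?expn_gt0 !pos.
move=> p; rewrite mem_primes => /andP[pr_p _].
rewrite p_part pfactor_dvdn // ?muln_gt0 ?pos //.
(* A common range exceeding the argument of every factorial involved. *)
pose K := (6 * k + 2 * m + 2)%N.
have log1 := @logn_fact_bound p (k + m).+1 K pr_p.
have log3 : logn p (k`! ^ 3) = (3 * logn p k`!)%N := lognX _ _ _.
have log2 : logn p (m`! ^ 2) = (2 * logn p m`!)%N := lognX _ _ _.
have pos3 : (0 < k`! ^ 3)%N by rewrite expn_gt0 pos.
have pos2 : (0 < m`! ^ 2)%N by rewrite expn_gt0 pos.
move: ((k + m).+1)`! (pos (k + m).+1) log1 => c1 pos1 log1.
move: (k`! ^ 3)%N (m`! ^ 2)%N log3 log2 pos3 pos2 => c3 c2 log3 log2 pos3 pos2.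
rewrite !lognM ?muln_gt0 ?pos ?pos1 ?pos2 ?pos3 // log1 ?log3 ?log2; last first.
  by rewrite /K; lia.
rewrite !(@logn_fact_bound p _ K) //; try by rewrite /K; lia.
rewrite !big_distrr -!big_split /= big_seq [X in (_ <= X)%N]big_seq.
apply: leq_sum => e; rewrite mem_index_iota => /andP[e0 _].
apply: floor_ineq_gen; apply: leq_trans (prime_gt1 pr_p) _.
by rewrite -{1}[p]expn1 leq_pexp2l // prime_gt0.
Qed.
(** * Integrality *)

Definition fps_int (f : fps rat) := forall n, coefq f n \is a Num.int.

Lemma fps_intD f g : fps_int f -> fps_int g -> fps_int (f + g).
Proof. by move=> If Ig n; rewrite coefqD rpredD. Qed.

Lemma fps_intN f : fps_int f -> fps_int (- f).
Proof. by move=> If n; rewrite coefqN rpredN. Qed.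

Lemma fps_intM f g : fps_int f -> fps_int g -> fps_int (f * g).
Proof. by move=> If Ig n; rewrite coefqM rpred_sum // => j _; rewrite rpredM. Qed.

Lemma fps_int1 : fps_int 1.
Proof. by move=> n; rewrite coefq1 natr_int. Qed.

Lemma fps_int_nat m : fps_int m%:R.
Proof. by move=> n; rewrite coefqMn rpredMn // coefq1 natr_int. Qed.

Lemma fps_intX f m : fps_int f -> fps_int (f ^+ m).
Proof.
move=> If; elim: m => [|m IHm]; first exact: fps_int1.
by rewrite exprS; apply: fps_intM.
Qed.

Lemma fps_intV f : fps_int f -> coefq f 0 = 1 -> fps_int f^-1.
Proof.
move=> If f0; elim/ltn_ind => n IHn.
have := congr1 (fun h => coefq h n) (mulVr (fps_unit1 f0)).
rewrite coefqM big_ord_recr subnn f0 mulr1 => /(canRL (addKr _)) ->.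
rewrite rpredD ?rpredN ?rpred_sum ?coefq1 ?natr_int // => i _.
by apply: rpredM; [apply: IHn; case: i | exact: If].
Qed.

Lemma fps_int_comp c : fps_int t -> fps_int c -> fps_int (fps_comp t c).
Proof.
move=> It Ic n; rewrite /= rpred_sum // => i _.
by rewrite rpredM ?Ic // (fps_intX _ It).
Qed.

Lemma fps_int_lambert k : fps_int (lambert k).
Proof.
by move=> n; rewrite coefq_lambert rpred_sum // => p _; rewrite rpredX ?natr_int.
Qed.

Lemma fps_int_E4 : fps_int E4.
Proof.
exact: (fps_intD fps_int1 (fps_intM (fps_int_nat 240) (fps_int_lambert 3))).
Qed.

Lemma fps_int_Delta : fps_int Delta.
Proof.
have Iq : fps_int 'q by move=> n; rewrite natr_int.
apply: (fps_intM Iq) => n; rewrite [coefq _ n]/=.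
suff : fps_int (euler24_partial n) by [].
rewrite /euler24_partial; elim/big_ind: _ => //; first exact: fps_int1.
  exact: fps_intM.
move=> m _; apply/fps_intX/fps_intD; first exact: fps_int1.
exact: fps_intN (fps_intX _ Iq).
Qed.

Lemma fps_int_hauptmodul : fps_int t.
Proof.
apply: fps_intM fps_int_Delta _; apply: fps_intV.
  exact: fps_intX fps_int_E4.
by rewrite !exprS expr0 !coefq0M coefq_E4_0 coefq1 !mulr1.
Qed.

(** Substitute x = 1 - 1/f in the series of (1 - x)^(-1/2), the case r = 1/4 of
    [central_binom_series]. *)
Lemma sqrt_exists (f : fps rat) : coefq f 0 = 1 ->
  exists2 g : fps rat, coefq g 0 = 1 & g ^+ 2 = f.
Proof.
move=> f0; have uf := fps_unit1 f0.
have y0 : coefq (1 - f^-1) 0 = 0.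
  have := coefq0M f^-1 f; rewrite mulVr // f0 mulr1 coefqB => <-.
  by rewrite subrr.
exists (fps_comp (1 - f^-1) (central_binom_series 4^-1)).
  by rewrite coefq0_fps_comp /= mulr1.
have := congr1 (fps_comp (1 - f^-1)) (central_binom_square 4^-1).
rewrite expr2 !fps_compM // fps_compD // fps_comp1.
have -> : 4 * fpsC 4^-1 * 'q = 'q.
  have -> : (4 : fps rat) = fpsC 4.
    by apply: fpsP => n; rewrite coefqMn coefq1; case: n.
  by rewrite -fpsCM divff // mul1r.
rewrite fps_compN // fps_comp_fpsq // subKr -expr2 => H.
have uV : f^-1 \is a GRing.unit by rewrite unitrV.
by apply: (mulIr uV); rewrite H divrr.
Qed.

(** * F4a and F4b as differentials in the hauptmodul *)

Lemma hauptmodul_E6 : E6 ^+ 2 = E4 ^+ 3 * (1 - 1728 * t).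
Proof.
apply: (eq_of_multiple (c := 1728) hauptmodul_E4).
by apply: (eq_of_multiple (c := 1) Delta_E4_E6); ring.
Qed.

Local Notation A := sqrtE4_series.
Local Notation B := (central_binom_series 432).

Lemma fps_comp_1728 : fps_comp t (1 - 4 * fpsC 432 * 'q) = 1 - 1728 * t.
Proof.
have t0 := coefq_hauptmodul0.
rewrite fps_compD // fps_comp1 fps_compN // -mulrA fps_compMnat.
rewrite fps_compM // fps_comp_fpsC fps_comp_fpsq //.
have -> : fpsC 432 = 432 :> fps rat.
  by apply: fpsP => n; rewrite coefqMn coefq1; case: n.
by ring.
Qed.

(** Both sides are square roots of E4^3 / E6^2 = 1 / (1 - 1728 t) with constant term 1; here 1728 =
    4 * 432. *)
Lemma central_binom_comp f : coefq f 0 = 1 -> f ^+ 2 = E4 ->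
  f ^+ 3 / E6 = fps_comp t B.
Proof.
have t0 := coefq_hauptmodul0.
move=> f0 f2; apply: fps_sqrt_unique.
- rewrite -[LHS]mulr1 -{1}coefq_E6_0 -coefq0M divrK ?E6_unit //.
  by rewrite !exprS expr0 !coefq0M coefq1 f0 !mulr1.
- by rewrite coefq0_fps_comp /= mulr1.
have := congr1 (fps_comp t) (central_binom_square 432).
rewrite expr2 !fps_compM // fps_comp_1728 fps_comp1 -expr2 => H.
have u : E6 ^+ 2 \is a GRing.unit by rewrite unitrX ?E6_unit.
apply: (mulIr u); rewrite exprMn exprVn divrK // hauptmodul_E6.
rewrite mulrCA H mulr1 -f2; ring.
Qed.

(** The series of (1 - 1728 x)^(-3/2), that is B^3, in a form that shows its coefficients (2m + 1)
    C(2m, m) 432^m to be multiples of central binomials. *)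
Definition twisted_binom_series : fps rat := B + 2 * derivq B.

Lemma twisted_binom_comp :
  fps_comp t twisted_binom_series * (1 - 1728 * t) = fps_comp t B.
Proof.
rewrite -fps_comp_1728 -fps_compM ?coefq_hauptmodul0 //; congr (fps_comp t _).
rewrite /twisted_binom_series.
by apply: (eq_of_multiple (c := 2) (central_binom_ODE 432)); ring.
Qed.

(** With f = E4^(1/2) the right side is f (f^3 / E6) (t E6 / E4) = t E4 = Delta / E4^2. *)
Lemma F4a_comp : F4a = fps_comp t (A * B) * derivq t.
Proof.
have [f f0 f2] := sqrt_exists coefq_E4_0.
rewrite fps_compM ?coefq_hauptmodul0 // -(sqrtE4_comp f0 f2).
rewrite -(central_binom_comp f0 f2) /F4a.
have u : E4 ^+ 2 \is a GRing.unit by rewrite unitrX ?E4_unit.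
apply: (mulIr u); rewrite divrK // -hauptmodul_E4.
have r6 : E6^-1 * E6 = 1 by rewrite mulVr ?E6_unit.
apply: (eq_of_multiple (c := - (f ^+ 4 * E6^-1 * E4)) derivq_hauptmodul).
apply: (eq_of_multiple (c := - (t * E4 * f ^+ 4)) r6).
apply: (eq_of_multiple (c := - (t * E4 * (f ^+ 2 + E4))) f2).
by ring.
Qed.

(** Relative to [F4a_comp] there is an extra factor 1 / (1 - 1728 t) = E4^3 / E6^2, which turns t E4
    into t E4^4 / E6^2 = E4 Delta / E6^2. *)
Lemma F4b_comp : F4b = fps_comp t (A * twisted_binom_series) * derivq t.
Proof.
have [f f0 f2] := sqrt_exists coefq_E4_0.
rewrite fps_compM ?coefq_hauptmodul0 // -(sqrtE4_comp f0 f2).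
have := twisted_binom_comp; rewrite -(central_binom_comp f0 f2) /F4b.
move: (fps_comp _ _) => h hE.
have u : E6 ^+ 2 \is a GRing.unit by rewrite unitrX ?E6_unit.
apply: (mulIr u); rewrite divrK // -hauptmodul_E4.
have r6 : E6^-1 * E6 = 1 by rewrite mulVr ?E6_unit.
apply: (eq_of_multiple (c := - (f * h * derivq t)) hauptmodul_E6).
apply: (eq_of_multiple (c := - (f * derivq t * E4 ^+ 3)) hE).
apply: (eq_of_multiple (c := - (f ^+ 4 * E6^-1 * E4 ^+ 2)) derivq_hauptmodul).
apply: (eq_of_multiple (c := - (t * E4 ^+ 2 * f ^+ 4)) r6).
apply: (eq_of_multiple (c := - (t * E4 ^+ 2 * (f ^+ 2 + E4))) f2).
by ring.
Qed.

Lemma coef_term_int k m :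
  sqrtE4_coef k * 'C(m.*2, m)%:R / (k + m).+1%:R \is a Num.int.
Proof.
have /dvdnP[c E] := fact_quotient_dvd k m.
have n0 n : (n`!%:R != 0 :> rat) by rewrite pnatr_eq0 -lt0n fact_gt0.
have mm : (m <= m.*2)%N by rewrite -addnn leq_addr.
have := bin_fact mm; rewrite -{2}addnn addnK => Eb.
suff -> : sqrtE4_coef k * 'C(m.*2, m)%:R / (k + m).+1%:R = c%:R by rewrite natr_int.
have En : ('C(m.*2, m) * (6 * k)`! = c * ((k + m).+1 * ((3 * k)`! * k`! ^ 3)))%N.
  apply/eqP; rewrite -(@eqn_pmul2r (m`! ^ 2)) ?expn_gt0 ?fact_gt0 //; apply/eqP.
  rewrite -!mulnA in E *; rewrite -E mul2n -Eb -mulnn; ring.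
have d0 : ((3 * k)`! * k`! ^ 3)%N%:R != 0 :> rat.
  by rewrite pnatr_eq0 -lt0n muln_gt0 expn_gt0 !fact_gt0.
have N0 : (k + m).+1%:R != 0 :> rat by rewrite pnatr_eq0.
apply: (mulIf N0); rewrite divfK //; apply: (mulIf d0).
rewrite /sqrtE4_coef mulrAC divfK // -!natrM; congr (_%:R).
by rewrite mulnC En mulnA.
Qed.

(** By the chain rule c(t) delta t = delta(C(t)) for the primitive C of c; C(t) is integral because
    both C and t are. *)
Lemma comp_derivq_int (F c : fps rat) :
    F = fps_comp t c * derivq t ->
    (forall n, coefq c n / n.+1%:R \is a Num.int) ->
  exists2 G, fps_int G & F = derivq G.
Proof.
(* Termwise integration shifts the index by one; at n = 0 division by zero gives the coefficient
   0. *)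
move=> -> cint; pose C := Fps (fun n => coefq c n.-1 / n%:R).
exists (fps_comp t C).
  apply: fps_int_comp fps_int_hauptmodul _ => -[|n]; last exact: cint.
  by rewrite /= invr0 mulr0.
rewrite derivq_fps_comp ?coefq_hauptmodul0 //; congr (fps_comp t _ * _).
by apply: fpsP => n /=; rewrite mulrC divfK // pnatr_eq0.
Qed.

(** The coefficient of x^n is a sum over k + m = n, so n + 1 is the divisor k + m + 1 of
    [coef_term_int]; [e] holds the remaining integer factor. *)
Lemma coef_product_int (b : fps rat) (e : nat -> nat) :
    (forall m, coefq b m = 'C(m.*2, m)%:R * (e m)%:R) ->
  forall n, coefq (A * b) n / n.+1%:R \is a Num.int.
Proof.
move=> bE n; rewrite coefqM mulr_suml rpred_sum // => i _.
have lein : (i <= n)%N by rewrite -ltnS.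
rewrite bE [coefq A i]/= mulrA mulrAC rpredM ?natr_int //.
by have := coef_term_int i (n - i); rewrite subnKC.
Qed.

Lemma derivq_int_antiderivative (F : fps rat) : F = F4a \/ F = F4b ->
  exists2 G, fps_int G & F = derivq G.
Proof.
have B_e m : coefq B m = 'C(m.*2, m)%:R * (432 ^ m)%N%:R by rewrite natrX.
case=> ->; [apply: (comp_derivq_int F4a_comp)|apply: (comp_derivq_int F4b_comp)].
  exact: coef_product_int B_e.
apply: (@coef_product_int _ (fun m => (2 * m + 1) * 432 ^ m)%N) => m.
rewrite coefqD coefq_natM coefq_derivq B_e natrM natrD natrM.
ring.
Qed.

Theorem theorem1 (F : fps rat) (hF : F = F4a \/ F = F4b) :
  exists a : nat -> int,
    [/\ a 0%N = 0,
        forall n : nat, coefq F n = (a n)%:~R,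
        forall n : nat, coefq (antideriv F) n \is a Num.int
      & forall n : nat, (0 < n)%N -> (n %| a n)%Z].
Proof.
have [G Gint ->] := derivq_int_antiderivative hF.
have dG n : coefq (derivq G) n = (n%:Z * Num.floor (coefq G n))%:~R.
  by rewrite coefq_derivq intrM floorK.
(* [Num.floor] carries the integral rational coefficients of [G] over to [int]. *)
exists (fun n => n%:Z * Num.floor (coefq G n)); split=> //.
- by rewrite mul0r.
(* At n = 0 the quotient is 0 / 0 = 0; elsewhere the coefficient of [G] is recovered. *)
- case=> [|n]; first by rewrite /= invr0 mulr0.
  by rewrite /= mulrAC mulfV ?mul1r ?pnatr_eq0.
by move=> n _; apply: dvdz_mulr.
Qed.
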